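(* Let $d\ge1$, $\alpha>d$, and let $\mathcal{X}_n=\{X_1,\dots,X_n\}$ be i.i.d. samples in $\mathbb{R}^d$ from the density $f_{\mathrm p}(x)=\dfrac{c_{\mathrm p}}{1+\|x\|^\alpha}$. Let $\{R_n\}$ be a sequence of positive numbers, and let $\beta_{k,n}=\beta_k\big(\check{C}(\mathcal{X}_n\cap (B_{R_n}(0))^c,1)\big)$. If $\lim_{n\to\infty}nR_n^{-\alpha}=0$, then $$\lim_{n\to\infty}\big(nR_n^{d-\alpha}\big)^{-1}\mathbb{E}\{\beta_{0,n}\}=\mu_{\mathrm p,0},$$ $$\lim_{n\to\infty}\big(n^{k+2}R_n^{d-\alpha(k+2)}\big)^{-1}\mathbb{E}\{\beta_{k,n}\}=\mu_{\mathrm p,k},\qquad 1\le k\le d-1,$$ where $$\mu_{\mathrm p,0}=\frac{s_{d-1}c_{\mathrm p}}{\alpha-d},\qquad \mu_{\mathrm p,k}=\frac{s_{d-1}c_{\mathrm p}^{k+2}}{(\alpha(k+2)-d)(k+2)!}\int_{(\mathbb{R}^d)^{k+1}}T_k(0,\mathbf{y})\,d\mathbf{y}\quad(1\le k\le d-1).$$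
   Context: $\|\cdot\|$ is the Euclidean norm; $B_r(x)$ is the closed Euclidean ball of radius $r$ about $x$; $c_{\mathrm p}>0$ is the normalization constant making $f_{\mathrm p}$ a probability density; $s_{d-1}$ is the surface area of the $(d-1)$-dimensional unit sphere in $\mathbb{R}^d$. For a finite set $\mathcal{Y}\subset\mathbb{R}^d$ and $\varepsilon>0$, the Čech complex $\check{C}(\mathcal{Y},\varepsilon)$ is the abstract simplicial complex with vertex set $\mathcal{Y}$ in which $[x_{i_0},\dots,x_{i_m}]$ is a simplex iff $\bigcap_{j=0}^m B_\varepsilon(x_{i_j})\neq\emptyset$. $\beta_k$ denotes the $k$-th Betti number (rank of the $k$-th homology group). For $k\ge1$ and finite $\mathcal{Y}\subset\mathbb{R}^d$, $T_k(\mathcal{Y})=1$ if $|\mathcal{Y}|=k+2$ and $\beta_k(\check{C}(\mathcal{Y},1))=1$, and $T_k(\mathcal{Y})=0$ otherwise; for $\mathbf{y}=(y_1,\dots,y_{k+1})\in(\mathbb{R}^d)^{k+1}$, $T_k(0,\mathbf{y})=T_k(\{0,y_1,\dots,y_{k+1}\})$. *)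

(* Defs.v *)
From HB Require Import structures.
From mathcomp Require Import all_boot all_order all_algebra finmap.
From mathcomp Require Import all_classical all_reals all_analysis.

Set Implicit Arguments.
Unset Strict Implicit.
Unset Printing Implicit Defensive.

Import Order.TTheory GRing.Theory Num.Theory.
Import numFieldNormedType.Exports.

Local Open Scope ring_scope.

Section homology.
Variable V : finType.
Implicit Types (K : {set {set V}}) (s t : {set V}) (k : nat).

(* Indexed by cardinality: the simplices of dimension k form [faces K k.+1],
   and [faces K 0] is empty (homology is not reduced). *)
Definition faces K m : {set {set V}} :=
  [set s in K | (s != finset.set0) && (#|s| == m)]%SET.

(* Coefficient of t in the boundary of s, each simplex being oriented by the
   enumeration order of V: the sum has at most one term. *)
Definition incidence s t : int :=
  \sum_(v in s | (s :\ v)%SET == t)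
    (-1) ^+ #|[set w in s | (enum_rank w < enum_rank v)%N]%SET|.

(* The boundary map C_k(K; Z) -> C_(k-1)(K; Z), acting on row vectors. *)
Definition boundary K k : 'M[int]_(#|faces K k.+1|, #|faces K k|) :=
  \matrix_(i, j) incidence (enum_val i) (enum_val j).

(* There are m integral k-cycles, the rows of Z, that are linearly independent
   over the integers modulo the boundaries. *)
Definition indep_cycles K k m : Prop :=
  exists Z : 'M[int]_(m, #|faces K k.+1|),
    Z *m boundary K k = 0 /\
    forall (a : 'rV[int]_m) (b : 'rV[int]_#|faces K k.+2|),
      a *m Z = b *m boundary K k.+1 -> a = 0.

(* Rank of the abelian group H_k(K; Z); such an m is at most the rank
   #|faces K k.+1| of the group of k-chains. *)
Definition betti K k : nat :=
  \max_(m < #|faces K k.+1|.+1 | `[< indep_cycles K k m >]) m.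

End homology.

Local Open Scope classical_set_scope.

Section euclidean.
Context {R : realType} {d : nat}.
Implicit Types (x y : d.-tuple R) (A : set (d.-tuple R)) (Y : {fset d.-tuple R}).

Definition edist x y : R :=
  Num.sqrt (\sum_(i < d) (tnth x i - tnth y i) ^+ 2).

Definition origin : d.-tuple R := [tuple 0 | i < d].

Definition enorm x : R := edist x origin.

Definition eball x (r : R) : set (d.-tuple R) := [set y | edist y x <= r].

Definition tube A (h : R) : set (d.-tuple R) := \bigcup_(x in A) eball x h.

Definition cech Y (eps : R) : {set {set Y}} :=
  [set s : {set Y} | (s != finset.set0) &&
    `[< \bigcap_(v in [set v : Y | v \in s]) eball (val v) eps !=set0 >]]%SET.

Definition cech_betti Y (eps : R) (k : nat) : nat := betti (cech Y eps) k.

Definition cycle_ind (k : nat) Y : R :=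
  if (#|` Y| == k.+2) && (cech_betti Y 1 k == 1%N) then 1 else 0.

Definition cycle_ind0 (k : nat) (y : k.+1.-tuple (d.-tuple R)) : R :=
  cycle_ind k (origin |` [fset tnth y i | i in 'I_k.+1])%fset.

Definition power_law (c alpha : R) x : R := c / (1 + enorm x `^ alpha).

End euclidean.

Section power_measure.
Local Open Scope ereal_scope.
Context {disp : measure_display} {T : measurableType disp} {R : realType}.

(* The n-fold product of m with itself is built by recursion on n, transporting
   the binary product along the bijection (x, t) |-> x :: t. *)
Definition cons_pair n (p : T * n.-tuple T) : n.+1.-tuple T :=
  [tuple of p.1 :: p.2].

Lemma measurable_cons_pair n : measurable_fun setT (@cons_pair n).
Proof. exact: measurable_cons. Qed.

Definition uncons_pair n (t : n.+1.-tuple T) : T * n.-tuple T :=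
  (thead t, [tuple of behead t]).

Lemma cons_pairK n : cancel (@cons_pair n) (@uncons_pair n).
Proof. by case=> x t; congr pair; apply/val_inj. Qed.

Lemma measurable_uncons_pair n : measurable_fun setT (@uncons_pair n).
Proof.
by apply: measurable_fun_pair; [exact: measurable_tnth|exact: measurable_behead].
Qed.

Variable m : {sigma_finite_measure set T -> \bar R}.

Section step.
Variables (n : nat) (mu : {sigma_finite_measure set (n.-tuple T) -> \bar R}).

Definition mcons : set (n.+1.-tuple T) -> \bar R :=
  pushforward (m \x mu) (@cons_pair n).

Let mcons0 : mcons set0 = 0.
Proof. by rewrite /mcons /pushforward preimage_set0 measure0. Qed.

Let mcons_ge0 A : 0 <= mcons A.
Proof. exact: (measure_ge0 (m \x mu)). Qed.

Let mcons_sigma_additive : semi_sigma_additive mcons.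
Proof.
move=> F mF tF mUF; rewrite /mcons /pushforward preimage_bigcup.
apply: (@measure_semi_sigma_additive _ _ _ (m \x mu)).
- by move=> i; rewrite -[X in measurable X]setTI; exact: measurable_cons_pair.
- apply/trivIsetP => /= i j _ _ ij; rewrite -preimage_setI.
  by move/trivIsetP : tF => /(_ _ _ _ _ ij) ->//; rewrite preimage_set0.
- rewrite -preimage_bigcup -[X in measurable X]setTI.
  exact: measurable_cons_pair.
Qed.

HB.instance Definition _ :=
  isMeasure.Build _ _ _ mcons mcons0 mcons_ge0 mcons_sigma_additive.

Let mcons_sigma_finite : sigma_finite setT mcons.
Proof.
have /sigma_finiteP[F [TF ndF Foo]] := sigma_finiteT m.
have /sigma_finiteP[G [TG ndG Goo]] := sigma_finiteT mu.
exists (fun i => @uncons_pair n @^-1` (F i `*` G i)).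
  rewrite -preimage_bigcup -(@preimage_setT _ _ (@uncons_pair n)); congr preimage.
  rewrite -setXTT TF TG predeqE => -[x y]; split; last first.
    by move=> [i _ []/= ? ?]; split; exists i.
  move=> [/= [i _ Fix] [j _ Gjy]]; exists (maxn i j) => //; split.
  - by move: x Fix; exact/subsetPset/ndF/leq_maxl.
  - by move: y Gjy; exact/subsetPset/ndG/leq_maxr.
move=> i; have [mF Fi] := Foo i; have [mG Gi] := Goo i; split.
  rewrite -[X in measurable X]setTI.
  by apply: measurable_uncons_pair => //; exact: measurableX.
rewrite /mcons /pushforward -comp_preimage.
rewrite (_ : _ \o _ = id) ?preimage_id; last exact/funext/cons_pairK.
by rewrite product_measure1E// lte_mul_pinfty// ge0_fin_numE.
Qed.

HB.instance Definition _ :=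
  Measure_isSigmaFinite.Build _ _ _ mcons mcons_sigma_finite.

End step.

Fixpoint mpow n : {sigma_finite_measure set (n.-tuple T) -> \bar R} :=
  match n with
  | 0 => \d_[tuple]
  | n.+1 => mcons (mpow n)
  end.

End power_measure.

Section sampling.
Local Open Scope ereal_scope.
Context {disp disp' : measure_display} {Omega : measurableType disp}
  {T : measurableType disp'} {R : realType} {P : probability Omega R}.

Definition mutually_independent (X : nat -> {RV P >-> T}) : Prop :=
  forall (J : {fset nat}) (A : nat -> set T), (forall i, measurable (A i)) ->
    P (\bigcap_(i in [set` J]) X i @^-1` A i) =
    \prod_(i <- J) P (X i @^-1` A i).

Definition has_density (mu : set T -> \bar R) (X : {RV P >-> T}) (f : T -> R) :
    Prop :=
  forall A, measurable A -> distribution P X A = \int[mu]_(x in A) (f x)%:E.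

End sampling.

Section lebesgue.
Local Open Scope ereal_scope.
Context {R : realType}.

Definition lebesgue_Rd d :
    {sigma_finite_measure set (d.-tuple (measurableTypeR R)) -> \bar R} :=
  mpow (@lebesgue_measure R) d.

(* The (d-1)-dimensional Minkowski content, which is the surface area when A is
   a smooth compact hypersurface. *)
Definition surface_area d (A : set (d.-tuple R)) : \bar R :=
  lim (lebesgue_Rd d (tube A h) * ((2 * h)^-1)%:E @[h --> 0^'+]).

Definition sphere_area d : \bar R :=
  surface_area [set x : d.-tuple R | enorm x = 1%R].

Definition mu_p0 d (c alpha : R) : \bar R :=
  sphere_area d * (c / (alpha - d%:R))%:E.

Definition mu_p d (c alpha : R) (k : nat) : \bar R :=
  sphere_area d *
  (c ^+ k.+2 / ((alpha * k.+2%:R - d%:R) * (k.+2)`!%:R))%:E *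
  \int[mpow (lebesgue_Rd d) k.+1]_y (cycle_ind0 y)%:E.

End lebesgue.

Section crackle.
Context {disp : measure_display} {Omega : measurableType disp} {R : realType}
  {P : probability Omega R} {d : nat}.
Variable X : nat -> {RV P >-> d.-tuple (measurableTypeR R)}.

(* Indices start at 0: this is the set {X 0, ..., X n.-1}. *)
Definition sample (n : nat) (w : Omega) : {fset d.-tuple R} :=
  [fset X i w | i in iota 0 n]%fset.

Definition outer_betti (r : nat -> R) (k n : nat) (w : Omega) : R :=
  (cech_betti [fset x in sample n w | x \notin eball origin (r n)]%fset 1 k)%:R.

End crackle.

(* Main.v *)
From HB Require Import structures.
From Pilot Require Import Defs.
From mathcomp Require Import all_boot all_order all_algebra finmap.
From mathcomp Require Import all_classical all_reals all_analysis.
From mathcomp Require Import measurable_realfun ring lra.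

(** Far from the origin the sample is so sparse that, to first order, the topology of the
Cech complex comes from the smallest configurations that can carry it: single points for
the zeroth Betti number, and for [k >= 1] hollow configurations of [k.+2] points, whose
nerve is the boundary of a simplex.

For a fixed sample, the [k]-th Betti number differs from the number of these clusters by
at most the number of tuples with one point more, all within a fixed distance of the first
([betti_le_clusters], [clusters_le_betti] and their versions in dimension 0). This is a
purely combinatorial fact about a simplicial complex: boundaries of isolated hollow sets
are independent in homology ([betti_ge_hollow]), and a cycle that avoids the faces with
two further vertices nearby and one facet of every hollow set is a boundary
([betti_le_hollow]).

It remains to find the expected number of clusters. By independence it is a binomial
coefficient times the probability that a tuple with the product density forms a cluster
outside the ball of radius [r] ([expected_clusters]). In this probability the position
[x] of the first point separates from the shape of the cluster. The shape is bounded, so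
the density at every point of the cluster is [c |x| ^ (- alpha)] up to a factor that tends
to 1 with growing [r]. The probability of a cluster of [m] points is therefore asymptotic
to [c ^ m] times the integral of the indicator over all shapes times the integral of
[|x| ^ (- alpha m)] over [|x| > r] ([cluster_prob_lb], [cluster_prob_ub]). The latter is
[r ^ (d - alpha m) / (alpha m - d)] times the area of the unit sphere, by scaling
([tail_integralE], [sphere_areaE]).

The same estimate with one point more shows that the error term is smaller than the main
term by the factor [n r ^ (- alpha)], which tends to 0 by hypothesis
([expectation_cvg]). *)

Set Implicit Arguments.
Unset Strict Implicit.
Unset Printing Implicit Defensive.

Import Order.TTheory GRing.Theory Num.Theory.
Import numFieldNormedType.Exports.

Local Open Scope classical_set_scope.
Local Open Scope ring_scope.

Local Notation edist := Pilot.Defs.edist.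

(** * Integral cycles as functions on vertex sets *)

Section int_kernel.

Lemma rat_row_clear m (v : 'rV[rat]_m) :
  exists2 D : int, D != 0 &
    exists a : 'rV[int]_m, map_mx intr a = D%:~R *: v.
Proof.
exists (\prod_i denq (v 0 i)); first by apply/prodf_neq0 => i _; exact: denq_neq0.
exists (\row_j (numq (v 0 j) * \prod_(i | i != j) denq (v 0 i))).
apply/rowP => j; rewrite !mxE [in RHS](bigD1 j)//= !intrM.
rewrite mulrAC -[X in _ = _ * X * _](divq_num_den (v 0 j)) [_%:~R * (_ / _)]mulrC divfK//.
by rewrite intr_eq0 denq_neq0.
Qed.

(** The rational left kernel is nonzero for dimension reasons, and clearing the
denominators of one of its vectors gives an integral one. *)
Lemma int_left_kernel m n (A : 'M[int]_(m, n)) : (n < m)%N ->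
  exists2 a : 'rV[int]_m, a != 0 & a *m A = 0.
Proof.
move=> nm; pose B : 'M[rat]_(m, n) := map_mx intr A.
have : kermx B != 0.
  rewrite -mxrank_eq0 mxrank_ker subn_eq0 -ltnNge.
  by rewrite (leq_ltn_trans (rank_leq_col B)).
case/rowV0Pn => v vB v0; have {}vB : v *m B = 0 by apply/sub_kermxP.
have [D D0 [a aE]] := rat_row_clear v.
exists a.
  apply: contraNneq v0 => a0; move: aE; rewrite a0 map_mx0 => /esym/eqP.
  by rewrite scaler_eq0 intr_eq0 (negbTE D0).
suff : map_mx (intr : int -> rat) (a *m A) = 0.
  move/matrixP => aA0; apply/matrixP => i j; rewrite [in RHS]mxE.
  by have := aA0 i j; rewrite mxE [in RHS]mxE => /eqP; rewrite intr_eq0 => /eqP.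
by rewrite map_mxM/= aE -scalemxAl vB scaler0.
Qed.

End int_kernel.

Section incidence.
Variable V : finType.
Implicit Types (K : {set {set V}}) (s t u : {set V}) (k : nat).

Definition vertex_sign s (v : V) : int :=
  (-1) ^+ #|[set w in s | (enum_rank w < enum_rank v)%N]%SET|.

Lemma setD1_inj s (v w : V) : v \in s -> w \in s -> (s :\ v = s :\ w)%SET -> v = w.
Proof.
by move=> vs ws /setP/(_ v); rewrite !inE eqxx vs !andbT/= => /esym/negbFE/eqP.
Qed.

Lemma incidence_facet s v : v \in s -> incidence s (s :\ v) = vertex_sign s v.
Proof.
move=> vs; rewrite /incidence (big_pred1 v) // => w.
apply/andP/eqP => [[ws /eqP /(setD1_inj ws vs)]//|->]; by rewrite eqxx.
Qed.

Lemma incidence_facet_sqr s v :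
  v \in s -> incidence s (s :\ v) * incidence s (s :\ v) = 1.
Proof. by move=> vs; rewrite incidence_facet// -expr2 sqrr_sign. Qed.

Lemma incidence_neq0 s t : incidence s t != 0 -> exists2 v, v \in s & t = (s :\ v)%SET.
Proof.
move=> st.
have [v /andP[vs /eqP <-]|none] := pickP (fun v => (v \in s) && (s :\ v == t)%SET).
  by exists v.
by move: st; rewrite /incidence big_pred0 ?eqxx.
Qed.

Lemma vertex_sign_swap s v w : v \in s -> w \in s -> v != w ->
  vertex_sign s v * vertex_sign (s :\ v) w =
  - (vertex_sign s w * vertex_sign (s :\ w) v).
Proof.
wlog vw : v w / (enum_rank v < enum_rank w)%N => [hw vs ws vw|].
  have [lt|gt|/val_inj/enum_rank_inj e] := ltngtP (enum_rank v) (enum_rank w).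
  - exact: hw.
  - by rewrite [in RHS]hw ?opprK// eq_sym.
  - by rewrite e eqxx in vw.
move=> vs ws _; rewrite /vertex_sign -!exprD.
have -> : [set x in s :\ w | (enum_rank x < enum_rank v)%N]%SET =
          [set x in s | (enum_rank x < enum_rank v)%N]%SET.
  apply/setP => x; rewrite !inE.
  by case: eqVneq => //= ->; rewrite ltnNge (ltnW vw) andbF.
have -> : #|[set x in s | (enum_rank x < enum_rank w)%N]%SET| =
   #|[set x in s :\ v | (enum_rank x < enum_rank w)%N]%SET|.+1.
  rewrite (cardsD1 v) inE vs vw add1n; congr _.+1; congr #|pred_of_set _|.
  by apply/setP => x; rewrite !inE andbA.
by rewrite addSn exprS mulN1r opprK addnC.
Qed.

(** The boundary of a boundary vanishes: a codimension two face [u] of [s] arises by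
removing two vertices in either order, and the two orders carry opposite signs. *)
Lemma incidence_incidence s u : \sum_t incidence s t * incidence t u = 0.
Proof.
pose E := \sum_(v in s) \sum_(w in s | (v != w) && (s :\ v :\ w == u)%SET)
  vertex_sign s v * vertex_sign (s :\ v) w.
have -> : \sum_t incidence s t * incidence t u = E.
  under eq_bigr do rewrite {1}/incidence mulr_suml big_mkcondr/=.
  rewrite exchange_big/=; apply: eq_bigr => v vs.
  rewrite -big_mkcond/= (big_pred1 (s :\ v)%SET) => [|t]; last by rewrite eq_sym.
  rewrite {1}/incidence mulr_sumr; apply: eq_bigl => w.
  by rewrite !inE [w == v]eq_sym andbA [_ && (w \in s)]andbC.
have EN : E = - E.
  rewrite {1}/E (exchange_big_dep (mem s))/=; last by move=> ? ? ? /andP[].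
  rewrite /E -sumrN; apply: eq_bigr => w ws; rewrite -sumrN.
  apply: eq_big => [v|v /and4P[vs _ vw _]].
    rewrite [w == v]eq_sym ws/= (_ : s :\ w :\ v = s :\ v :\ w)%SET ?andbA//.
    by apply/setP => x; rewrite !inE andbCA.
  exact: vertex_sign_swap.
have /eqP : E *+ 2 = 0 by rewrite mulr2n {1}EN addNr.
by rewrite mulrn_eq0 => /eqP.
Qed.

End incidence.

Section chains.
Variable V : finType.
Variable K : {set {set V}}.
Implicit Types (s t u : {set V}) (k : nat).

Definition is_cycle k (z : {set V} -> int) :=
  forall t, t \in faces K k -> \sum_(s in faces K k.+1) z s * incidence s t = 0.

Definition bounds k (z : {set V} -> int) (b : {set V} -> int) :=
  forall s, s \in faces K k.+1 -> z s = \sum_(u in faces K k.+2) b u * incidence u s.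

Lemma row_boundary k n (z : 'I_n -> {set V} -> int) i j :
  ((\matrix_(i < n, j < #|faces K k.+1|) z i (enum_val j)) *m boundary K k) i j =
  \sum_(s in faces K k.+1) z i s * incidence s (enum_val j).
Proof.
rewrite mxE [RHS]big_enum_val; apply: eq_bigr => l _.
by rewrite !mxE.
Qed.

Lemma chain_of_row k (a : 'rV[int]_#|faces K k|) :
  exists b : {set V} -> int, forall j, a 0 j = b (enum_val j).
Proof.
exists (fun s => \sum_(j | enum_val j == s) a 0 j) => j.
by rewrite (big_pred1 j)// => i; apply/eqP/eqP => [/enum_val_inj|->].
Qed.

(** Together with [indep_cyclesE], this trades the matrices indexed by enumerations of
the faces for integral functions on vertex sets, where sums over faces can be extended
to sums over all sets. *)
Lemma indep_cyclesI k n (z : 'I_n -> {set V} -> int) :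
  (forall i, is_cycle k (z i)) ->
  (forall (a : 'I_n -> int) b, bounds k (fun s => \sum_i a i * z i s) b ->
    forall i, a i = 0) ->
  indep_cycles K k n.
Proof.
move=> zc zi; exists (\matrix_(i, j) z i (enum_val j)); split.
  by apply/matrixP => i j; rewrite row_boundary mxE; apply: zc; exact: enum_valP.
move=> a b ab; have [b' b'E] := chain_of_row b.
apply/rowP => i; rewrite mxE; apply: (zi (fun i => a 0 i) b') => s sK.
have /rowP/(_ (enum_rank_in sK s)) := ab; rewrite mxE.
under eq_bigr do rewrite mxE enum_rankK_in//; move=> ->.
have -> : b = \matrix_(i < 1, j < _) (fun=> b') i (enum_val j).
  by apply/rowP => j; rewrite mxE b'E.
by rewrite (row_boundary (fun=> b')) enum_rankK_in.
Qed.

Lemma indep_cyclesE k n : indep_cycles K k n ->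
  exists z : 'I_n -> {set V} -> int,
  (forall i, is_cycle k (z i)) /\
  (forall (a : 'I_n -> int) b, bounds k (fun s => \sum_i a i * z i s) b ->
    forall i, a i = 0).
Proof.
move=> [Z [Zc Zi]].
have /choice[z zE] : forall i, exists b : {set V} -> int, forall j, Z i j = b (enum_val j).
  by move=> i; have [b bE] := chain_of_row (row i Z); exists b => j; rewrite -bE mxE.
have ZE : Z = \matrix_(i, j) z i (enum_val j) by apply/matrixP => i j; rewrite mxE zE.
exists z; split => [i t tK|a b ab i].
  have /matrixP/(_ i (enum_rank_in tK t)) := Zc.
  by rewrite ZE row_boundary mxE enum_rankK_in.
suff /rowP/(_ i) : \row_i a i = 0 by rewrite !mxE.
apply: (Zi _ (\matrix_(i < 1, j < _) (fun=> b) i (enum_val j))).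
apply/rowP => j; rewrite (row_boundary (fun=> b)) -ab ?enum_valP// mxE.
by apply: eq_bigr => l _; rewrite mxE zE.
Qed.

Lemma indep_cycles_le k n : indep_cycles K k n -> (n <= #|faces K k.+1|)%N.
Proof.
move=> [Z [_ Zi]]; rewrite leqNgt; apply/negP => lt.
have [a /eqP a0 aZ] := int_left_kernel Z lt.
by apply: a0; apply: (Zi _ 0); rewrite mul0mx.
Qed.

Lemma betti_ge k n : indep_cycles K k n -> (n <= betti K k)%N.
Proof.
move=> ic; have nle := indep_cycles_le ic.
apply: (@leq_bigmax_cond _ _ (fun i : 'I_#|faces K k.+1|.+1 => i : nat) (Ordinal (nle : (n < #|faces K k.+1|.+1)%N))).
exact/asboolP.
Qed.

Lemma betti_le k n : (forall m, indep_cycles K k m -> (m <= n)%N) ->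
  (betti K k <= n)%N.
Proof. by move=> h; apply/bigop.bigmax_leqP => i /asboolP; exact: h. Qed.

End chains.

(** * Betti numbers and hollow simplices *)

Section hollow.
Variable V : finType.
Variable K : {set {set V}}.
Variable adj : rel V.
Implicit Types (s t f S T : {set V}) (v w : V) (k : nat).

Hypothesis adj_face : forall s, s \in K -> {in s &, forall v w, adj v w}.
Hypothesis K_down : forall s t, s \in K -> t \subset s -> t != finset.set0 -> t \in K.

Definition nbr f v := (v \notin f) && [exists u in f, adj u v].

(** A face is big when it can be enlarged twice by a neighbour, so that it lies in a
connected set with two vertices more. Such faces are rare in a sparse sample. *)
Definition big_face f := [exists v, exists w, nbr f v && nbr (v |: f)%SET w].

Definition isolated S := [forall v, ~~ nbr S v].

(** The full boundary of the simplex on [S] is present; [S] itself may be a face or,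
if [S] is hollow, the boundary is a cycle without a filling. *)
Definition tight k S := (#|S| == k.+2) && [forall v in S, (S :\ v)%SET \in K].

Definition hollow k S := tight k S && (S \notin K).

Lemma nbr_uniq f v w : ~~ big_face f -> nbr f v -> nbr f w -> v = w.
Proof.
move=> nb fv /andP[wf /exists_inP[u uf uw]]; apply/eqP; apply: contraNT nb => vw.
apply/existsP; exists v; apply/existsP; exists w; rewrite fv /nbr !inE negb_or wf.
rewrite eq_sym vw/=; apply/exists_inP; exists u => //.
by rewrite !inE uf orbT.
Qed.

Lemma nbr_isolated f v : ~~ big_face f -> nbr f v -> isolated (v |: f)%SET.
Proof.
move=> nb fv; apply/forallP => w; apply: contra nb => fvw.
by apply/existsP; exists v; apply/existsP; exists w; rewrite fv.
Qed.

Lemma nbr_facet S v w : isolated S -> nbr (S :\ v)%SET w -> w = v.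
Proof.
move=> /forallP/(_ w) iS /andP[]; rewrite !inE negb_and negbK => /orP[/eqP//|wS].
move=> /exists_inP[u]; rewrite !inE => /andP[_ uS] uw.
by case/negP: iS; rewrite /nbr wS; apply/exists_inP; exists u.
Qed.

Lemma facet_notbig S v : isolated S -> v \in S -> ~~ big_face (S :\ v)%SET.
Proof.
move=> iS vS; apply/existsP => -[w /existsP[w' /andP[/(nbr_facet iS)-> ]]].
by rewrite finset.setD1K//; apply/negP; apply: (forallP iS).
Qed.

Section positive_dimension.
Variable k : nat.
Hypothesis k0 : (0 < k)%N.

Lemma faces_tight S : S \in faces K k.+2 -> tight k S.
Proof.
rewrite inE => /and3P[SK _ cS]; rewrite /tight cS.
apply/forall_inP => v vS; apply: (K_down SK); first exact: finset.subsetDl.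
by rewrite -card_gt0; move: cS; rewrite (cardsD1 v) vS add1n eqSS => /eqP->.
Qed.

Lemma tight_facet S v : tight k S -> v \in S -> (S :\ v)%SET \in faces K k.+1.
Proof.
move=> /andP[cS /forall_inP SK] vS; rewrite inE SK//=.
move: cS; rewrite (cardsD1 v) vS add1n eqSS => /[dup] + ->.
by rewrite andbT -card_gt0 => /eqP->.
Qed.

(** This is where a positive dimension is needed: for [u] in the facet there is a third
vertex, and the facet opposite to it contains both [u] and [v]. *)
Lemma tight_nbr S v : tight k S -> v \in S -> nbr (S :\ v)%SET v.
Proof.
move=> /andP[/eqP cS /forall_inP SK] vS; rewrite /nbr !inE eqxx/=.
have cSv : #|(S :\ v)%SET| = k.+1 by apply/eqP; rewrite -eqSS -cS (cardsD1 v S) vS.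
have /card_gt0P[u uSv] : (0 < #|(S :\ v)%SET|)%N by rewrite cSv.
have /card_gt0P[w] : (0 < #|(S :\ v :\ u)%SET|)%N.
  by move: cSv; rewrite (cardsD1 u) uSv add1n => -[->].
rewrite !inE => /and3P[wu wv wS].
apply/exists_inP; exists u => //; move: uSv; rewrite !inE => /andP[uv uS].
by apply: (adj_face (SK w wS)); rewrite !inE eq_sym ?uS ?vS ?wv ?wu.
Qed.

(** The vertex opposite to the shared facet in [T] is a neighbour of that facet, and
the only neighbour of a facet of an isolated set is the vertex that was removed. *)
Lemma isolated_facet_inj S T v w : isolated S -> tight k T ->
  v \in S -> w \in T -> (S :\ v = T :\ w)%SET -> S = T.
Proof.
move=> iS tT vS wT e; have := tight_nbr tT wT; rewrite -e => /(nbr_facet iS) wv.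
by rewrite -(finset.setD1K vS) e -wv finset.setD1K.
Qed.

Lemma incidence_isolated S T v : isolated S -> tight k T -> v \in S ->
  incidence T (S :\ v)%SET != 0 -> T = S.
Proof.
move=> iS tT vS /incidence_neq0[w wT e].
exact/esym/(isolated_facet_inj iS tT vS wT e).
Qed.

Lemma faces_down f (u : V) : f \in faces K k.+1 -> u \in f -> (f :\ u)%SET \in faces K k.
Proof.
rewrite !inE => /and3P[fK f0 cf] uf.
have cfu : #|(f :\ u)%SET| == k by rewrite -eqSS -(eqP cf) (cardsD1 u f) uf.
have fu0 : (f :\ u)%SET != finset.set0 by rewrite -card_gt0 (eqP cfu).
by rewrite (K_down fK)//= ?fu0 ?finset.subsetDl.
Qed.

(** The coefficient of the boundary of [z] at the facet [f :\ u] vanishes, so some other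
face of the support contains this facet; its extra vertex is a neighbour of [f]. *)
Lemma cycle_extend z f (u : V) : is_cycle K k z -> f \in faces K k.+1 -> z f != 0 ->
  u \in f -> exists v, [/\ nbr f v, (v |: (f :\ u))%SET \in faces K k.+1 &
    z (v |: (f :\ u))%SET != 0].
Proof.
move=> zc fK zf uf; have tK := faces_down fK uf.
have := zc _ tK; rewrite (bigD1 f)//=; set rest := \sum_(_ in _ | _) _ => e.
have rest0 : rest != 0.
  apply: contra_eq_neq e => ->; rewrite addr0 mulf_neq0//.
  by rewrite incidence_facet// signr_eq0.
have [s /andP[/andP[sK sf]]|none] := pickP
    (fun s => (s \in faces K k.+1) && (s != f) && (z s * incidence s (f :\ u) != 0)); last first.
  case/eqP: rest0; apply: big1 => s sP; apply/eqP; have := none s.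
  by rewrite sP => /negbFE.
rewrite mulf_eq0 negb_or => /andP[zs /incidence_neq0[v vs e']].
have sE : s = (v |: (f :\ u))%SET by rewrite e' finset.setD1K.
have vf : v \notin f.
  apply: contra sf => vf; have : v \notin (f :\ u)%SET by rewrite e' !inE eqxx.
  by rewrite !inE vf andbT negbK => /eqP vu; rewrite sE vu finset.setD1K.
exists v; rewrite -sE; split => //; rewrite /nbr vf/=.
have /card_gt0P[u' u't] : (0 < #|(f :\ u)%SET|)%N.
  by move: tK; rewrite inE => /and3P[_ _ /eqP->].
apply/exists_inP; exists u'; first by move: u't; rewrite !inE => /andP[].
have sK' : s \in K by case/setIdP: sK.
apply: (adj_face sK') => //.
by rewrite sE !inE; move: u't; rewrite !inE => ->; rewrite orbT.
Qed.

(** A face [f] in the support is not big, so it has a single neighbour [v]; by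
[cycle_extend] all the facets of [v |: f] are then in the support, which makes this set
tight and isolated and contradicts the vanishing at one of its facets. *)
Lemma cycle_eq0 z : is_cycle K k z ->
  (forall f, f \in faces K k.+1 -> big_face f -> z f = 0) ->
  (forall S, tight k S -> isolated S -> exists2 v, v \in S & z (S :\ v)%SET = 0) ->
  forall f, f \in faces K k.+1 -> z f = 0.
Proof.
move=> zc zb zS f fK; apply/eqP/negPn/negP => zf.
have nb : ~~ big_face f by apply: contraNN zf => /zb->.
have [fK' f0 /eqP cf] : [/\ f \in K, f != finset.set0 & #|f| == k.+1].
  by apply/and3P; move: fK; rewrite inE.
have /finset.set0Pn[u0 u0f] := f0.
have [v [fv _ _]] := cycle_extend zc fK zf u0f.
have vf : v \notin f by case/andP: fv.
have vfE : ((v |: f) :\ v = f)%SET by rewrite finset.setU1K.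
have sub (u : V) : u \in f -> ((v |: f) :\ u)%SET \in faces K k.+1 /\ z ((v |: f) :\ u)%SET != 0.
  move=> uf; have [v' [fv']] := cycle_extend zc fK zf uf.
  rewrite -(nbr_uniq nb fv fv') (_ : (v |: f) :\ u = v |: (f :\ u))%SET//.
  apply/setP => x; rewrite !inE.
  by case: (eqVneq x u) => [->|//]; rewrite orbF; apply/esym/negbTE; apply: contraNneq vf => <-.
have tS : tight k (v |: f)%SET.
  rewrite /tight cardsU1 vf cf add1n eqxx/=; apply/forall_inP => u; rewrite !inE => /orP[/eqP->|uf].
    by rewrite vfE.
  by have [+ _] := sub u uf; rewrite inE => /andP[].
have [u] := zS _ tS (nbr_isolated nb fv).
rewrite !inE => /orP[/eqP->|/sub[_ /eqP//]].
by rewrite vfE => zf0; rewrite zf0 eqxx in zf.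
Qed.

(** The isolated faces of dimension one more give boundaries that can be subtracted
without interfering with one another, because no two of them share a facet. What is left
satisfies the hypotheses of [cycle_eq0]. *)
Lemma cycle_bounds z : is_cycle K k z ->
  (forall f, f \in faces K k.+1 -> big_face f -> z f = 0) ->
  (forall S, hollow k S -> exists2 v, v \in S & z (S :\ v)%SET = 0) ->
  exists b, bounds K k z b.
Proof.
move=> zc zb zS.
(* [b] is chosen to cancel [z] at the facet of [S] opposite to the picked vertex. *)
pose b S := if [pick v in S] is Some v then
  (if isolated S then incidence S (S :\ v) * z (S :\ v)%SET else 0) else 0.
exists b => f fK; apply/eqP; rewrite -subr_eq0; apply/eqP; move: f fK.
pose B f := \sum_(u in faces K k.+2) b u * incidence u f.
have BE S v : isolated S -> v \in S ->
    B (S :\ v)%SET = if S \in faces K k.+2 then b S * incidence S (S :\ v)%SET else 0.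
  move=> iS vS; rewrite /B; case: ifPn => SK.
    rewrite (bigD1 S)//= big1 ?addr0// => T /andP[TK TS].
    apply/eqP; rewrite mulf_eq0; apply/orP; right; apply: contraNT TS.
    by move=> /(incidence_isolated iS (faces_tight TK) vS)->.
  rewrite big1// => T TK.
  apply/eqP; rewrite mulf_eq0; apply/orP; right; apply: contraNT SK.
  by move=> /(incidence_isolated iS (faces_tight TK) vS)<-.
apply: cycle_eq0.
- move=> t tK; under eq_bigr do rewrite mulrBl; rewrite sumrB zc// sub0r.
  under eq_bigr do rewrite mulr_suml; rewrite exchange_big/= big1 ?oppr0// => S SK.
  under eq_bigr do rewrite -mulrA; rewrite -mulr_sumr.
  rewrite (_ : \sum_(_ in _) _ = \sum_f incidence S f * incidence f t).
    by rewrite incidence_incidence mulr0.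
  rewrite [RHS](bigID (mem (faces K k.+1)))/= [X in _ = _ + X]big1 ?addr0// => f fK.
  apply/eqP; rewrite mulf_eq0; apply/orP; left; apply: contraNT fK.
  by move=> /incidence_neq0[v vS ->]; exact: tight_facet (faces_tight SK) vS.
- move=> f fK fb; rewrite zb// sub0r; apply/eqP; rewrite oppr_eq0; apply/eqP.
  rewrite big1// => S SK; rewrite /b.
  case: pickP => [v vS|]; last by rewrite mul0r.
  case: ifPn => [iS|]; last by rewrite mul0r.
  apply/eqP; rewrite mulf_eq0; apply/orP; right; apply: contraTT fb.
  by move=> /incidence_neq0[w wS ->]; exact: facet_notbig.
move=> S tS iS; have [SK|SK] := boolP (S \in K); last first.
  have [|v vS zv] := zS S; first by rewrite /hollow tS.
  exists v => //; rewrite -/(B _) BE// zv ifF ?subrr//.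
  by rewrite inE (negbTE SK).
have SK2 : S \in faces K k.+2.
  by rewrite inE SK (andP tS).1 andbT -card_gt0 (eqP (andP tS).1).
have bS : b S = if [pick v in S] is Some v then incidence S (S :\ v) * z (S :\ v)%SET else 0.
  by rewrite /b iS.
move: bS; case: pickP => [v vS bS|none _]; last first.
  have /card_gt0P[v] : (0 < #|S|)%N by rewrite (eqP (andP tS).1).
  by rewrite none.
exists v => //; rewrite -/(B _) BE// SK2 bS mulrAC incidence_facet_sqr//.
by rewrite mul1r subrr.
Qed.

(** If there were more independent cycles than big faces and hollow sets together, some
nonzero integral combination of them would vanish on all big faces and on one chosen
facet of each hollow set, hence would bound by [cycle_bounds]. *)
Lemma betti_le_hollow :
  (betti K k <= #|[set S | hollow k S]%SET| +
               #|[set f in faces K k.+1 | big_face f]%SET|)%N.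
Proof.
apply: betti_le => m /indep_cyclesE[z [zc zi]]; rewrite leqNgt; apply/negP => lt.
pose facet S : {set V} := if [pick v in S] is Some v then (S :\ v)%SET else S.
pose Q := ([set facet S | S in [set S | hollow k S]] :|:
          [set f in faces K k.+1 | big_face f])%SET.
have Qm : (#|Q| < m)%N.
  apply: leq_ltn_trans lt; apply: (leq_trans (leq_card_setU _ _)).
  by rewrite leq_add2r leq_imset_card.
pose A : 'M[int]_(m, #|Q|) := \matrix_(i, j) z i (enum_val j).
have [a /eqP a0 aA] := int_left_kernel A Qm; apply: a0.
pose y s := \sum_i a 0 i * z i s.
have yQ f : f \in Q -> y f = 0.
  move=> fQ; have /rowP/(_ (enum_rank_in fQ f)) := aA; rewrite !mxE => <-.
  by apply: eq_bigr => i _; rewrite mxE enum_rankK_in.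
have yc : is_cycle K k y.
  move=> t tK; under eq_bigr do rewrite mulr_suml.
  rewrite exchange_big/= big1// => i _; under eq_bigr do rewrite -mulrA.
  by rewrite -mulr_sumr zc// mulr0.
have [||b yb] := cycle_bounds yc; last 1 first.
- by apply/rowP => i; rewrite mxE; apply: (zi (fun i => a 0 i) b).
- by move=> f fK fb; apply: yQ; rewrite !inE in fK *; rewrite fK fb orbT.
move=> S hS; have : y (facet S) = 0.
  by apply: yQ; rewrite finset.in_setU; apply/orP; left; apply: imset_f; rewrite inE.
rewrite /facet; case: pickP => [v vS|none _]; first by exists v.
have /card_gt0P[v] : (0 < #|S|)%N by case/andP: hS => /andP[/eqP->].
by rewrite none.
Qed.

(** The boundaries of the isolated hollow sets are independent cycles: a facet of such
a set lies in no face of dimension one more and in no other tight set. *)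
Lemma betti_ge_hollow :
  (#|[set S | hollow k S && isolated S]%SET| <= betti K k)%N.
Proof.
set H := [set S | _]%SET; apply: betti_ge.
have HP (i : 'I_#|H|) : [/\ tight k (enum_val i), enum_val i \notin K & isolated (enum_val i)].
  by have := enum_valP i; rewrite inE => /andP[/andP[]].
apply: (@indep_cyclesI _ _ _ _ (fun i => incidence (enum_val i))).
  move=> i t tK; rewrite -[RHS](incidence_incidence (enum_val i) t).
  rewrite [RHS](bigID (mem (faces K k.+1)))/= [X in _ = _ + X]big1 ?addr0// => f fK.
  apply/eqP; rewrite mulf_eq0; apply/orP; left; apply: contraNT fK.
  by move=> /incidence_neq0[v vS ->]; apply: tight_facet vS; case: (HP i).
move=> a b ab i; have [tS SK iS] := HP i; set S := enum_val i in tS SK iS *.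
have /card_gt0P[v vS] : (0 < #|S|)%N by case/andP: tS => /eqP->.
have := ab _ (tight_facet tS vS); rewrite [RHS]big1 => [|T TK]; last first.
  apply/eqP; rewrite mulf_eq0; apply/orP; right; apply: contraNT SK.
  move=> /(incidence_isolated iS (faces_tight TK) vS) <-.
  by move: TK; rewrite inE => /andP[].
rewrite (bigD1 i)//= big1 ?addr0 => [/eqP|j ji].
  by rewrite mulf_eq0 incidence_facet// signr_eq0 orbF => /eqP.
have [tT _ _] := HP j.
apply/eqP; rewrite mulf_eq0; apply/orP; right; apply: contraNT ji.
by move=> /(incidence_isolated iS tT vS)/enum_val_inj->.
Qed.

End positive_dimension.

Lemma betti0_le : (betti K 0 <= #|V|)%N.
Proof.
apply: betti_le => m /indep_cycles_le/leq_trans; apply.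
rewrite -(card_imset V (@finset.set1_inj V)); apply: subset_leq_card; apply/fintype.subsetP => s.
by rewrite inE => /and3P[_ _ /cards1P[v ->]]; apply: imset_f.
Qed.

(** An isolated vertex is a cycle that no edge meets. *)
Lemma betti0_ge :
  (#|[set v | ([set v]%SET \in K) && isolated [set v]]%SET| <= betti K 0)%N.
Proof.
set H := [set v | _]%SET; apply: betti_ge.
apply: (@indep_cyclesI _ _ _ _ (fun i s => (s == [set enum_val i]%SET)%:R)).
  move=> i t; rewrite inE => /and3P[_ t0 /eqP/eqP]; by rewrite finset.cards_eq0 (negbTE t0).
move=> a b ab i; have := enum_valP i; rewrite inE => /andP[vK iv].
have sK : [set enum_val i]%SET \in faces K 1.
  by rewrite inE vK cards1 eqxx andbT -card_gt0 cards1.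
have := ab _ sK; rewrite (bigD1 i)//= eqxx mulr1 [X in _ + X]big1 ?addr0; last first.
  move=> j ji; rewrite (_ : _ == _ = false) ?mulr0//; apply: contraNF ji.
  by move=> /eqP/finset.set1_inj/enum_val_inj->.
move=> ->; rewrite big1// => T TK; apply/eqP; rewrite mulf_eq0; apply/orP; right.
apply/negPn/negP => /incidence_neq0[v vT e].
case/negP: (forallP iv v); have uT : enum_val i \in T.
  have : enum_val i \in [set enum_val i]%SET by rewrite inE.
  by rewrite e !inE => /andP[].
rewrite /nbr e !inE eqxx/=; apply/exists_inP; exists (enum_val i).
  by rewrite -e inE.
by apply: (adj_face _ uT vT); move: TK; rewrite inE => /andP[].
Qed.

End hollow.

(** * Euclidean distances and hollow point configurations *)

Section counting.

(** Relational form of the comparison of cardinals by an injection, which spares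
choosing the injection on all of [T1] and with a default value. *)
Lemma card_le_rel (T1 T2 : finType) (A : {set T1}) (B : {set T2})
    (r : T1 -> T2 -> Prop) :
  (forall a, a \in A -> exists2 b, b \in B & r a b) ->
  (forall a a' b, a \in A -> a' \in A -> r a b -> r a' b -> a = a') ->
  (#|A| <= #|B|)%N.
Proof.
move=> AB rinj.
have /choice[F FP] : forall u : {a | a \in A}, exists b, b \in B /\ r (val u) b.
  by move=> [a aA] /=; have [b bB rab] := AB _ aA; exists b.
have Finj : injective F.
  move=> u v uv; apply/val_inj; apply: (rinj _ _ (F u)); try exact: valP.
    exact: (FP u).2.
  by rewrite uv; exact: (FP v).2.
have -> : #|A| = #|{: {a | a \in A}}|.
  by rewrite card_sig; apply: eq_card => a; rewrite inE.
rewrite -(card_imset {: {a | a \in A}} Finj); apply: subset_leq_card.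
by apply/fintype.subsetP => b /imsetP[u _ ->]; exact: (FP u).1.
Qed.

End counting.

Section euclid.
Context {R : realType} {d : nat}.
Implicit Types (p q x y z : d.-tuple R).

Lemma cauchy_schwarz (I : finType) (a b : I -> R) :
  (\sum_i a i * b i) ^+ 2 <= (\sum_i a i ^+ 2) * (\sum_i b i ^+ 2).
Proof.
have : 0 <= \sum_i \sum_j (a i * b j - a j * b i) ^+ 2.
  by apply: sumr_ge0 => i _; apply: sumr_ge0 => j _; exact: sqr_ge0.
have -> : \sum_i \sum_j (a i * b j - a j * b i) ^+ 2 =
    ((\sum_i a i ^+ 2) * (\sum_i b i ^+ 2) - (\sum_i a i * b i) ^+ 2) *+ 2.
  have e1 : \sum_i \sum_j a i ^+ 2 * b j ^+ 2 = (\sum_i a i ^+ 2) * (\sum_i b i ^+ 2).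
    by rewrite mulr_suml; apply: eq_bigr => i _; rewrite mulr_sumr.
  have e2 : \sum_i \sum_j (a i * b i) * (a j * b j) = (\sum_i a i * b i) ^+ 2.
    by rewrite expr2 mulr_suml; apply: eq_bigr => i _; rewrite mulr_sumr.
  have e3 : \sum_i \sum_j a j ^+ 2 * b i ^+ 2 = (\sum_i a i ^+ 2) * (\sum_i b i ^+ 2).
    by rewrite exchange_big.
  rewrite mulr2n -{1}e1 -{1}e3 -{1}e2 -{1}e2 addrACA -opprD -!big_split/=.
  rewrite -sumrN -big_split; apply: eq_bigr => i _ /=.
  rewrite -!big_split/= -sumrN -big_split; apply: eq_bigr => j _ /=; ring.
by rewrite pmulrn_lge0// subr_ge0.
Qed.

Definition norm2 (I : finType) (a : I -> R) := Num.sqrt (\sum_i a i ^+ 2).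

Lemma norm2_triangle (I : finType) (a b : I -> R) :
  norm2 (fun i => a i + b i) <= norm2 a + norm2 b.
Proof.
have s0 (c : I -> R) : 0 <= \sum_i c i ^+ 2 by apply: sumr_ge0 => i _; exact: sqr_ge0.
have n0 c : 0 <= norm2 c :> R by exact: sqrtr_ge0.
rewrite -(@ler_pXn2r _ 2)// ?nnegrE ?addr_ge0// sqrrD !sqr_sqrtr//.
have -> : \sum_i (a i + b i) ^+ 2 =
    \sum_i a i ^+ 2 + (\sum_i a i * b i) *+ 2 + \sum_i b i ^+ 2.
  by rewrite -sumrMnl -!big_split; apply: eq_bigr => i _; rewrite sqrrD.
rewrite lerD2r lerD2l lerMn2r/= /norm2 -sqrtrM//.
by rewrite (le_trans (ler_norm _))// -sqrtr_sqr ler_wsqrtr// cauchy_schwarz.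
Qed.

Lemma edist_ge0 x y : 0 <= edist x y.
Proof. exact: sqrtr_ge0. Qed.

Lemma edistC x y : edist x y = edist y x.
Proof.
by congr Num.sqrt; apply: eq_bigr => i _; rewrite -sqrrN opprB.
Qed.

Lemma edistxx x : edist x x = 0.
Proof. by rewrite /edist big1 ?sqrtr0// => i _; rewrite subrr expr0n. Qed.

Lemma edist_triangle y x z : edist x z <= edist x y + edist y z.
Proof.
rewrite (_ : edist x z = norm2 (fun i => (tnth x i - tnth y i) + (tnth y i - tnth z i))).
  exact: norm2_triangle.
by congr Num.sqrt; apply: eq_bigr => i _; rewrite addrA subrK.
Qed.

Lemma edist_triangle_le y x z (a b : R) :
  edist x y <= a -> edist y z <= b -> edist x z <= a + b.
Proof. by move=> xa zb; apply: le_trans (edist_triangle y _ _) (lerD xa zb). Qed.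

End euclid.

Section common.
Context {R : realType} {d : nat}.
Implicit Types (J : finType) (k : nat).

Definition common_at J (x : J -> d.-tuple R) (I : {set J}) : Prop :=
  exists p, forall i, i \in I -> edist p (x i) <= 1.

(** The nerve of the unit balls about the points [x i] is the boundary of a simplex. *)
Definition hollow_at J (x : J -> d.-tuple R) k (I : {set J}) : Prop :=
  [/\ #|I| = k.+2, forall i, i \in I -> common_at x (I :\ i)%SET & ~ common_at x I].

Lemma common_at_imset J J' (x : J -> d.-tuple R) (y : J' -> d.-tuple R)
    (g : J -> J') (I : {set J}) : {in I, forall i, y (g i) = x i} ->
  common_at y (g @: I)%SET <-> common_at x I.
Proof.
move=> gx; split=> -[p pP]; exists p; last by move=> _ /imsetP[i iI ->]; rewrite gx//; exact: pP.
by move=> i iI; rewrite -gx//; apply: pP; exact: imset_f.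
Qed.

Lemma hollow_at_imset J J' (x : J -> d.-tuple R) (y : J' -> d.-tuple R) k
    (g : J -> J') (I : {set J}) : {in I &, injective g} ->
    {in I, forall i, y (g i) = x i} ->
  hollow_at y k (g @: I)%SET <-> hollow_at x k I.
Proof.
move=> ginj gx.
have gD i : i \in I -> (g @: I :\ g i = g @: (I :\ i))%SET.
  move=> iI; apply/setP => j; rewrite !inE; apply/andP/imsetP.
    move=> [ji /imsetP[l lI e]]; exists l => //; rewrite !inE lI andbT.
    by apply: contraNneq ji => <-; rewrite e.
  move=> [l]; rewrite !inE => /andP[li lI] ->; split; last exact: imset_f.
  by apply: contra li => /eqP/ginj->.
have cD i : i \in I -> common_at y (g @: I :\ g i)%SET <-> common_at x (I :\ i)%SET.
  by move=> iI; rewrite gD//; apply: common_at_imset => j /setD1P[_]; exact: gx.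
rewrite /hollow_at card_in_imset//; split => -[cI cf nI]; split => //.
- by move=> i iI; apply/cD => //; apply: cf; exact: imset_f.
- by move=> /(common_at_imset gx).
- by move=> _ /imsetP[i iI ->]; apply/cD => //; exact: cf.
- by move=> /(common_at_imset gx).
Qed.

(** If two indices carried the same point, removing one of them would not change the
set of points, so a common point without it would be one for all. *)
Lemma hollow_at_inj J (x : J -> d.-tuple R) k (I : {set J}) :
  hollow_at x k I -> {in I &, injective x}.
Proof.
move=> [_ cf nI] i j iI jI xij; apply/eqP/negPn/negP => ij; apply: nI.
have [p pP] := cf i iI; exists p => l lI.
have [->|li] := eqVneq l i; first by rewrite xij; apply: pP; rewrite !inE eq_sym ij.
by apply: pP; rewrite !inE li.
Qed.

Lemma common_at_dist J (x : J -> d.-tuple R) (I : {set J}) i j :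
  common_at x I -> i \in I -> j \in I -> edist (x i) (x j) <= 2.
Proof.
move=> [p pP] iI jI; rewrite -[2]/(1 + 1 : R); apply: (edist_triangle_le _ (pP _ jI)).
by rewrite edistC; exact: pP.
Qed.

Lemma hollow_at_dist J (x : J -> d.-tuple R) k (I : {set J}) i j : (0 < k)%N ->
  hollow_at x k I -> i \in I -> j \in I -> edist (x i) (x j) <= 2.
Proof.
move=> k0 [cI cf _] iI jI; have : (0 < #|I :\ i :\ j|%SET)%N.
  move: cI; rewrite (cardsD1 i) iI (cardsD1 j (I :\ i)%SET) !inE jI andbT.
  by case: (j != i) => /=; case: #|_| => // -[] // e; move: k0; case: k e.
case/card_gt0P => l; rewrite !inE => /and3P[lj li lI].
by apply: (common_at_dist (cf l lI)); rewrite !inE ?iI ?jI eq_sym ?lj ?li.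
Qed.

End common.

Section cech.
Context {R : realType} {d : nat} (Y : {fset d.-tuple R}).
Implicit Types (S T : {set Y}) (k : nat).

Let K := cech Y 1.

Definition close (u v : Y) := edist (\val u) (\val v) <= 2.

Lemma cechE S : (S \in K) = (S != finset.set0) && `[< common_at val S >].
Proof.
rewrite inE; congr (_ && _); apply: asbool_equiv_eq; split=> -[p pP]; exists p.
Qed.

Lemma cech_adj S : S \in K -> {in S &, forall u v, close u v}.
Proof.
by rewrite cechE => /andP[_ /asboolP cS] u v uS vS; exact: common_at_dist cS uS vS.
Qed.

Lemma cech_down S T : S \in K -> T \subset S -> T != finset.set0 -> T \in K.
Proof.
rewrite !cechE => /andP[_ /asboolP[p pP]] /fintype.subsetP TS -> /=.
by apply/asboolP; exists p => v /TS; exact: pP.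
Qed.

Lemma cech_hollow k S : hollow K k S <-> hollow_at val k S.
Proof.
have n0 (T : {set Y}) m : #|T| = m.+1 -> T != finset.set0 by rewrite -card_gt0 => ->.
split=> [/andP[/andP[/eqP cS /forall_inP cf] nS]|[cS cf nS]].
  split => // [v vS|cS']; first by have := cf v vS; rewrite cechE => /andP[_ /asboolP].
  by move: nS; rewrite cechE (n0 _ _ cS) => /asboolP.
rewrite /hollow /tight cS eqxx cechE (n0 _ _ cS)/=; apply/andP; split; last exact/asboolP.
apply/forall_inP => v vS; rewrite cechE; apply/andP; split; last exact/asboolP/cf.
by apply: (n0 _ k); move: cS; rewrite (cardsD1 v S) vS => -[].
Qed.

(** With only [k.+2] vertices no face is big and a hollow set is the whole vertex set,
so the general bounds on the Betti number leave only 0 and 1. *)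
Lemma cech_betti_full k : (0 < k)%N -> #|` Y| = k.+2 ->
  (cech_betti Y 1 k == 1%N) <-> hollow_at (val : Y -> _) k [set: Y]%SET.
Proof.
move=> k0 cY; have cV : #|{: Y}| = k.+2 by rewrite -cY cardfE.
have nobig f : f \in faces K k.+1 -> ~~ big_face close f.
  rewrite inE => /and3P[_ _ /eqP cf].
  apply/existsP => -[v /existsP[w /andP[/andP[vf _] /andP[wf _]]]].
  by have := max_card (mem (w |: (v |: f))%SET); rewrite !cardsU1 vf wf cf cV ltnn.
have up := betti_le_hollow cech_adj cech_down k0.
have lo := betti_ge_hollow cech_adj cech_down k0.
have full S : hollow K k S -> S = [set: Y]%SET.
  move=> /cech_hollow[cS _ _]; apply/eqP; rewrite eqEcard finset.subsetT/=.
  by rewrite cardsT cV cS.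
have big0 : [set f in faces K k.+1 | big_face close f]%SET = finset.set0.
  apply/setP => f; rewrite inE finset.in_set0; apply/negbTE/negP.
  by move=> /andP[fK]; exact/negP/nobig.
split=> [/eqP b1|h].
  apply/cech_hollow; apply/negPn/negP => nh; move: up.
  rewrite -/(cech_betti Y 1 k) b1 big0 finset.cards0 addn0.
  move=> /card_gt0P[S]; rewrite inE => hS.
  by move: nh; rewrite -(full _ hS) hS.
rewrite eqn_leq; apply/andP; split.
  apply: (leq_trans up); rewrite -[1%N]addn0; apply: leq_add.
    rewrite -(cards1 [set: Y]%SET); apply: subset_leq_card.
    by apply/fintype.subsetP => S; rewrite !inE => /full->.
  by rewrite big0 finset.cards0.
apply: leq_trans lo; apply/card_gt0P; exists [set: Y]%SET; rewrite inE.
apply/andP; split; first exact/cech_hollow.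
by apply/forallP => v; rewrite /nbr inE.
Qed.

End cech.

Section tuple_hollow.
Context {R : realType} {d : nat}.

Definition hollow_tuple k (t : k.+2.-tuple (d.-tuple R)) : Prop :=
  hollow_at (tnth t) k [set: 'I_k.+2]%SET.

(** The indicator is written in terms of tuples, for which measurability and translation
invariance can be expressed. A tuple with repeated points is not hollow by
[hollow_at_inj], in accordance with the requirement on the cardinal. *)
Lemma cycle_ind0E k (y : k.+1.-tuple (d.-tuple R)) : (0 < k)%N ->
  cycle_ind0 y = (`[< hollow_tuple [tuple of @origin R d :: y] >])%:R.
Proof.
move=> k0; set t := [tuple of _ :: _]; rewrite /cycle_ind0 /cycle_ind.
set Y := (_ |` _)%fset.
have YE : Y = [fset tnth t i | i in 'I_k.+2]%fset.
  apply/fsetP => p; rewrite /Y in_fset1U; apply/orP/imfsetP => /=.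
    move=> [/eqP->|/imfsetP[i _ ->]]; first by exists ord0.
    by exists (lift ord0 i) => //; rewrite tnthS.
  move=> [i _ ->]; case: (unliftP ord0 i) => [j ->|->]; last by left.
  by right; apply/imfsetP; exists j => //; rewrite tnthS.
have tY i : tnth t i \in Y by rewrite YE; apply/imfsetP; exists i.
pose g i : Y := [` tY i]%fset.
case: eqP => [cY|ncY] /=; last first.
  case: asboolP => // /hollow_at_inj tinj; case: ncY; rewrite YE card_in_imfset/=.
    by rewrite -cardE card_ord.
  by move=> i j _ _; apply: tinj; rewrite inE.
have gT : (g @: [set: 'I_k.+2])%SET = [set: Y]%SET.
  apply/setP => v; rewrite inE; apply/imsetP.
  have vY : val v \in [fset tnth t i | i in 'I_k.+2]%fset by rewrite -YE; exact: valP.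
  have /imfsetP[i _ vi] := vY.
  exists i; rewrite ?inE//.
  exact/val_inj.
have ginj : {in [set: 'I_k.+2]%SET &, injective g}.
  by apply/imset_injP; rewrite gT !cardsT card_ord -cardfE cY.
have h := hollow_at_imset (x := tnth t) (y := val) k ginj (fun _ _ => erefl).
rewrite gT in h.
have -> : (cech_betti Y 1 k == 1%N) = `[< hollow_tuple t >].
  by apply/idP/asboolP => [/(cech_betti_full k0 cY)/h|/h/(cech_betti_full k0 cY)].
by case: asboolP.
Qed.

End tuple_hollow.

(** * Counting clusters of sample indices *)

Section counts.
Context {R : realType} {d n : nat}.
Variables (x : 'I_n -> d.-tuple R) (out : pred 'I_n).
Implicit Types (I : {set 'I_n}) (k m : nat).

Definition clusters m (h : {set 'I_n} -> Prop) : {set {set 'I_n}} :=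
  [set I : {set 'I_n} | [&& #|I| == m, [forall i in I, out i] & `[< h I >]]]%SET.

(** The bound 6 is what three steps of length 2 can reach: two points of a simplex,
a neighbour of the simplex, and a neighbour of that neighbour. *)
Definition near_tuples m : {set m.+1.-tuple 'I_n} :=
  [set t : m.+1.-tuple 'I_n |
    [&& uniq t, all out t & all (fun i => edist (x (thead t)) (x i) <= 6) t]]%SET.

Lemma near_tuplesI m a (s : seq 'I_n) : size s = m -> uniq (a :: s) -> all out (a :: s) ->
  (forall j, j \in s -> edist (x a) (x j) <= 6) ->
  exists2 t : m.+1.-tuple 'I_n, t \in near_tuples m & t = a :: s :> seq _.
Proof.
move=> ss us os near; have ssE : size (a :: s) == m.+1 by rewrite /= ss.
exists (Tuple ssE) => //; rewrite inE us os/=; apply/andP; split.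
  by rewrite edistxx ler0n.
exact/allP.
Qed.

Variable Y : {fset d.-tuple R}.
Hypothesis YP : forall p, p \in Y <-> exists2 i, out i & p = x i.

Lemma sample_index : exists idx : Y -> 'I_n, forall v, out (idx v) /\ x (idx v) = val v.
Proof.
have /choice[idx idxP] : forall v : Y, exists i, out i /\ x i = val v.
  by move=> v; have /YP[i oi xi] := valP v; exists i.
by exists idx.
Qed.

Lemma index_inj (idx : Y -> 'I_n) : (forall v, out (idx v) /\ x (idx v) = val v) ->
  injective idx.
Proof. by move=> idxP u v e; apply/val_inj; rewrite -(idxP u).2 e (idxP v).2. Qed.

(** A big face is read off from the first entries of the tuple that lists its vertices
followed by two successive neighbours. Each of these is within 6 of the first vertex. *)
Lemma big_face_le k :
  (#|[set f in faces (cech Y 1) k.+1 | big_face (@close R d Y) f]%SET| <= #|near_tuples k.+2|)%N.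
Proof.
have [idx idxP] := sample_index; have idx_inj := index_inj idxP.
apply: (@card_le_rel _ _ _ _ (fun (f : {set Y}) (t : k.+3.-tuple 'I_n) => map idx (enum f) = take k.+1 t)); last first.
  move=> f g t _ _ ft; rewrite -ft => /(inj_map idx_inj) fg; apply/setP => v.
  by rewrite -[v \in g]mem_enum fg mem_enum.
move=> f; rewrite inE => /andP[fK /existsP[v /existsP[w /andP[/andP[vf av] /andP[wvf aw]]]]].
have [fK' cf] : f \in cech Y 1 /\ #|f| = k.+1.
  by move: fK; rewrite inE => /and3P[-> _ /eqP].
have se : size (enum f) = k.+1 by rewrite -cardE.
case e : (enum f) se => [//|a s] [ss].
have mem_s u : (u \in f) = (u \in a :: s) by rewrite -e mem_enum.
have af : a \in f by rewrite mem_s mem_head.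
have daf u : u \in f -> edist (val a) (val u) <= 2.
  by move=> uf; exact: cech_adj fK' _ _ af uf.
have dv : edist (val a) (val v) <= 2 + 2.
  by case/exists_inP: av => u uf uv; exact: edist_triangle_le (daf _ uf) uv.
have dw : edist (val a) (val w) <= 2 + 2 + 2.
  case/exists_inP: aw => u; rewrite !inE => /orP[/eqP ->|uf] uw.
    exact: edist_triangle_le dv uw.
  by apply: edist_triangle_le uw; apply: (le_trans (daf _ uf)); lra.
have us : uniq (a :: s) by rewrite -e enum_uniq.
move: wvf; rewrite !inE negb_or => /andP[wv wf].
have [||| |t tN tE] := @near_tuplesI k.+2 (idx a) (map idx (rcons (rcons s v) w)).
- by rewrite size_map !size_rcons ss.
- rewrite -map_cons map_inj_uniq//= !(rcons_uniq, mem_rcons, inE) !negb_or wv.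
  move: us vf wf => /=; rewrite !mem_s !inE !negb_or => /andP[as_ us].
  move=> /andP[va vs] /andP[wa ws].
  by rewrite eq_sym wa eq_sym va as_ ws vs us.
- by rewrite -map_cons; apply/allP => j /mapP[u _ ->]; exact: (idxP u).1.
- move=> j /mapP[u]; rewrite !(mem_rcons, inE) => uP ->; rewrite !(idxP _).2.
  case/or3P : uP => [/eqP->|/eqP->|us'].
  + by apply: (le_trans dw); lra.
  + by apply: (le_trans dv); lra.
  + by apply: (le_trans (daf _ _)); [rewrite mem_s inE us' orbT|lra].
exists t => //; rewrite tE /= map_rcons map_rcons -!cats1 -catA take_size_cat//.
by rewrite size_map ss.
Qed.

Lemma betti_le_clusters k : (0 < k)%N ->
  (cech_betti Y 1 k <= #|clusters k.+2 (hollow_at x k)| + #|near_tuples k.+2|)%N.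
Proof.
move=> k0; have up := betti_le_hollow (@cech_adj _ _ Y) (@cech_down _ _ Y) k0.
apply: leq_trans up _; apply: leq_add; last exact: big_face_le.
have [idx idxP] := sample_index; have idx_inj := index_inj idxP.
apply: (@card_le_rel _ _ _ _ (fun (S : {set Y}) (I : {set 'I_n}) => I = (idx @: S)%SET)); last first.
  by move=> S T I _ _ -> /(imset_inj idx_inj).
move=> S; rewrite inE => /cech_hollow hS; exists (idx @: S)%SET => //.
have hI : hollow_at x k (idx @: S)%SET.
  by apply/(hollow_at_imset k _ _).2: hS => [u v _ _ /idx_inj//|u _]; exact: (idxP u).2.
rewrite inE; apply/and3P; split; last exact/asboolP.
  by case: hI => ->.
by apply/forall_inP => i /imsetP[v _ ->]; exact: (idxP v).1.
Qed.

(** A cluster with a further sample point within distance 2 of one of its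
members is the beginning of a near tuple. *)
Lemma crowded_clusters_le m (h : {set 'I_n} -> Prop) :
  (forall I, h I -> {in I &, forall i j, edist (x i) (x j) <= 2}) ->
  (#|[set I in clusters m.+1 h |
      [exists i in I, exists j, [&& j \notin I, out j & (edist (x i) (x j) <= 2)%R]]]%SET|
     <= #|near_tuples m.+1|)%N.
Proof.
move=> hd; apply: (@card_le_rel _ _ _ _ (fun (I : {set 'I_n}) (t : m.+2.-tuple 'I_n) => enum I = take m.+1 t)); last first.
  move=> f g t _ _ ft; rewrite -ft => fg; apply/setP => v.
  by rewrite -[v \in g]mem_enum fg mem_enum.
move=> I; rewrite !inE => /andP[/and3P[/eqP cI /forall_inP oI /asboolP hI]].
move=> /exists_inP[i iI /existsP[j /and3P[jI oj ij]]].
have se : size (enum I) = m.+1 by rewrite -cardE.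
case e : (enum I) se => [//|a s] [ss].
have mem_s u : (u \in I) = (u \in a :: s) by rewrite -e mem_enum.
have aI : a \in I by rewrite mem_s mem_head.
have us : uniq (a :: s) by rewrite -e enum_uniq.
have [||| |t tN tE] := @near_tuplesI m.+1 a (rcons s j).
- by rewrite size_rcons ss.
- rewrite -rcons_cons rcons_uniq us andbT; by rewrite mem_s in jI.
- by rewrite -rcons_cons all_rcons oj andTb; apply/allP => u; rewrite -mem_s; exact: oI.
- move=> u; rewrite mem_rcons inE => /orP[/eqP->|us'].
    have := edist_triangle_le (hd _ hI _ _ aI iI) ij => /le_trans; apply; lra.
  have uI : u \in I by rewrite mem_s inE us' orbT.
  by apply: (le_trans (hd _ hI _ _ aI uI)); lra.
exists t => //; rewrite tE -rcons_cons -cats1 take_size_cat//=.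
by rewrite ss.
Qed.

(** The clusters with no further sample point close by give distinct isolated hollow
sets of points: two index sets with the same points would be close to each other. *)
Lemma clusters_le_betti k : (0 < k)%N ->
  (#|clusters k.+2 (hollow_at x k)| <= cech_betti Y 1 k + #|near_tuples k.+2|)%N.
Proof.
move=> k0; have lo := betti_ge_hollow (@cech_adj _ _ Y) (@cech_down _ _ Y) k0.
set crowded := fun I => [exists i in I, exists j, [&& j \notin I, out j & (edist (x i) (x j) <= 2)%R]].
rewrite -(cardsID [set I | crowded I]%SET) addnC; apply: leq_add; last first.
  rewrite (_ : _ :&: _ = [set I in clusters k.+2 (hollow_at x k) | crowded I])%SET.
    by apply: crowded_clusters_le => I hI i j iI jI; exact: hollow_at_dist k0 hI iI jI.
  by apply/setP => I; rewrite !inE.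
apply: leq_trans lo.
apply: (@card_le_rel _ _ _ _ (fun (I : {set 'I_n}) (S : {set Y}) => forall p, (exists2 v, v \in S & val v = p) <->
   (exists2 i, i \in I & x i = p))).
  move=> I; rewrite !inE => /andP[nc /and3P[/eqP cI /forall_inP oI /asboolP hI]].
  have xY i : i \in I -> x i \in Y by move=> iI; apply/YP; exists i => //; exact: oI.
  have /card_gt0P[i0 i0I] : (0 < #|I|)%N by rewrite cI.
  pose g i : Y := insubd [` xY _ i0I]%fset (x i).
  have gE i : i \in I -> val (g i) = x i by move=> iI; rewrite /g insubdK// xY.
  have ginj : {in I &, injective g}.
    move=> i j iI jI e; apply: (hollow_at_inj hI) => //.
    by rewrite -gE// e gE.
  exists (g @: I)%SET; last first.
    move=> p; split=> [[v /imsetP[i iI ->] <-]|[i iI <-]].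
      by exists i => //; rewrite gE.
    by exists (g i); [exact: imset_f|rewrite gE].
  rewrite inE; apply/andP; split.
    by apply/cech_hollow/(hollow_at_imset k ginj gE).
  apply/forallP => v; apply/negP => /andP[vS /exists_inP[u /imsetP[i iI ->]]].
  rewrite /close gE// => uv; have /YP[j oj xj] := valP v.
  case/negP: nc; apply/exists_inP; exists i => //; apply/existsP; exists j.
  rewrite oj -xj uv andbT/= andbT; apply: contra vS => jI; apply/imsetP; exists j => //.
  by apply/val_inj; rewrite /= gE.
move=> I J S.
wlog suff sub : I J / I \in (clusters k.+2 (hollow_at x k) :\: [set I | crowded I])%SET ->
   J \in (clusters k.+2 (hollow_at x k) :\: [set I | crowded I])%SET ->
   (forall p, (exists2 v, v \in S & val v = p) <-> (exists2 i, i \in I & x i = p)) ->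
   (forall p, (exists2 v, v \in S & val v = p) <-> (exists2 i, i \in J & x i = p)) ->
   I \subset J.
  by move=> IC JC IS JS; apply/eqP; rewrite finset.eqEsubset !sub.
rewrite !inE => /andP[_ /and3P[_ /forall_inP oI _]] /andP[ncJ _] IS JS.
apply/fintype.subsetP => i iI; apply/negPn/negP => iJ.
have /IS/JS[j jJ xj] : exists2 j, j \in I & x j = x i by exists i.
case/negP: ncJ; apply/exists_inP; exists j => //; apply/existsP; exists i.
by rewrite iJ oI//= xj edistxx ler0n.
Qed.

Lemma betti0_le_clusters :
  (cech_betti Y 1 0 <= #|clusters 1 (fun=> True)| + #|near_tuples 1|)%N.
Proof.
have [idx idxP] := sample_index; have idx_inj := index_inj idxP.
apply: leq_trans (leq_addr _ _); apply: (leq_trans (betti0_le _)).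
rewrite -cardsT.
apply: (@card_le_rel _ _ _ _ (fun (v : Y) (I : {set 'I_n}) => I = [set idx v]%SET)); last first.
  by move=> u v I _ _ -> /finset.set1_inj/idx_inj.
move=> v _; exists [set idx v]%SET => //; rewrite inE cards1 eqxx/=.
apply/andP; split; last exact/asboolP.
by apply/forall_inP => i /finset.set1P ->; exact: (idxP v).1.
Qed.

Lemma clusters_le_betti0 :
  (#|clusters 1 (fun=> True)| <= cech_betti Y 1 0 + #|near_tuples 1|)%N.
Proof.
have lo := betti0_ge (@cech_adj _ _ Y).
set crowded := fun I => [exists i in I, exists j, [&& j \notin I, out j & (edist (x i) (x j) <= 2)%R]].
rewrite (_ : clusters 1 _ = clusters 1 (fun I => #|I| = 1%N)); last first.
  apply/setP => I; rewrite !inE; case: eqP => //= cI; congr (_ && _).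
  by apply/asboolP/asboolP.
rewrite -(cardsID [set I | crowded I]%SET) addnC; apply: leq_add; last first.
  rewrite (_ : _ :&: _ = [set I in clusters 1 (fun I => #|I| = 1%N) | crowded I])%SET.
    apply: crowded_clusters_le => I /eqP/cards1P[i ->] j l /finset.set1P-> /finset.set1P->.
    by rewrite edistxx.
  by apply/setP => I; rewrite !inE.
apply: leq_trans lo.
apply: (@card_le_rel _ _ _ _ (fun (I : {set 'I_n}) (v : Y) => exists2 i, i \in I & x i = val v)).
  move=> I; rewrite !inE => /andP[nc /and3P[/cards1P[i Ii] oI _]].
  move: nc oI; rewrite Ii => nc /forall_inP oI.
  have xY : x i \in Y by apply/YP; exists i => //; apply: oI; rewrite inE.
  exists [` xY]%fset; last by exists i; rewrite ?inE.
  rewrite inE cechE -andbA; apply/and3P; split.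
  - by rewrite -card_gt0 cards1.
  - apply/asboolP; exists (x i) => v /finset.set1P->.
    by rewrite /= edistxx.
  apply/forallP => v; apply/negP => /andP[vS /exists_inP[u /finset.set1P->]].
  rewrite /close /= => uv; have /YP[j oj xj] := valP v.
  case/negP: nc; apply/exists_inP; exists i; first by rewrite inE.
  apply/existsP; exists j.
  rewrite oj -xj uv andbT/= andbT inE; apply: contra vS => /eqP ji.
  by rewrite inE; apply/eqP/val_inj; rewrite /= -ji -xj.
move=> I J v; rewrite !inE => /andP[ncI /and3P[/cards1P[i Ii] oI _]].
move=> /andP[ncJ /and3P[/cards1P[j Jj] oJ _]].
move: ncI oI ncJ oJ; rewrite Ii Jj => ncI /forall_inP oI ncJ /forall_inP oJ.
move=> [_ /finset.set1P-> xi] [_ /finset.set1P-> xj]; congr [set _]%SET.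
apply/eqP/negPn/negP => ij; case/negP: ncI; apply/exists_inP; exists i; first by rewrite inE.
apply/existsP; exists j; rewrite inE eq_sym ij oJ ?inE//=.
by rewrite xi xj edistxx.
Qed.

End counts.

(** * Integration over powers of a measure *)

Section mpow_integral.
Local Open Scope ereal_scope.
Context {disp : measure_display} {T : measurableType disp} {R : realType}.
Implicit Types (m nu : {sigma_finite_measure set T -> \bar R}) (n : nat).

Lemma integral_mpow0 m (g : 0.-tuple T -> \bar R) : measurable_fun [set: 0.-tuple T] g ->
  \int[mpow m 0]_t g t = g [tuple].
Proof. by move=> mg; rewrite /= integral_dirac// diracT mul1e. Qed.

(** Tonelli, for the product with one more factor. *)
Lemma integral_mpowS m n (g : n.+1.-tuple T -> \bar R) :
  measurable_fun setT g -> (forall t, 0 <= g t) ->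
  \int[mpow m n.+1]_t g t = \int[m]_x \int[mpow m n]_t g [tuple of x :: t].
Proof.
move=> mg g0; rewrite /= /mcons ge0_integral_pushforward//; last exact: measurable_cons_pair.
rewrite preimage_setT fubini_tonelli1//.
  by apply: measurableT_comp => //; exact: measurable_cons_pair.
by move=> p; exact: g0.
Qed.

Lemma measurable_fun_cons_l n (g : n.+1.-tuple T -> \bar R) x :
  measurable_fun setT g -> measurable_fun setT (fun t : n.-tuple T => g [tuple of x :: t]).
Proof.
move=> mg; apply: measurableT_comp => //.
by apply: (@measurable_cons _ _ _ T (cst x) n id).
Qed.

Lemma measurable_integral_cons m n (g : n.+1.-tuple T -> \bar R) :
  measurable_fun setT g -> (forall t, 0 <= g t) ->
  measurable_fun setT (fun x => \int[mpow m n]_t g [tuple of x :: t]).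
Proof.
move=> mg g0.
apply: (@measurable_fun_fubini_tonelli_F _ _ _ _ R (mpow m n)
  (fun p : T * n.-tuple T => g [tuple of p.1 :: p.2])) => //.
by apply: measurableT_comp => //; exact: measurable_cons_pair.
Qed.

(** If each coordinate map multiplies integrals by [K^-1], the map acting
coordinatewise on [n]-tuples multiplies them by [K^-n]. *)
Lemma integral_mpow_map m (phi : nat -> T -> T) (K : R) : (0 <= K)%R ->
  (forall i, measurable_fun setT (phi i)) ->
  (forall i (g : T -> \bar R), measurable_fun setT g -> (forall x, 0 <= g x) ->
     \int[m]_x g x = K%:E * \int[m]_x g (phi i x)) ->
  forall n (g : n.-tuple T -> \bar R), measurable_fun setT g -> (forall t, 0 <= g t) ->
  \int[mpow m n]_t g t =
  (K ^+ n)%:E * \int[mpow m n]_t g [tuple phi i (tnth t i) | i < n].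
Proof.
move=> K0 mphi phiK n; elim: n phi mphi phiK => [|n IH] phi mphi phiK g mg g0.
  rewrite expr0 mul1e; apply: eq_integral => t _; congr g.
  by apply: eq_from_tnth => -[].
have mtmap k (psi : nat -> T -> T) : (forall i, measurable_fun setT (psi i)) ->
    measurable_fun setT (fun t : k.-tuple T => [tuple psi i (tnth t i) | i < k]).
  move=> mpsi; apply/measurable_fun_tnthP => i.
  rewrite (_ : _ \o _ = psi i \o (fun t => tnth t i)).
    exact: measurableT_comp (mpsi i) (measurable_tnth i).
  by apply/funext => t /=; rewrite tnth_mktuple.
rewrite integral_mpowS// [in RHS]integral_mpowS//; last first.
  by apply: measurableT_comp => //; exact: mtmap.
have step x : \int[mpow m n]_t g [tuple phi i (tnth [tuple of x :: t] i) | i < n.+1] =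
    \int[mpow m n]_t g [tuple of phi 0%N x :: [tuple phi i.+1 (tnth t i) | i < n]].
  apply: eq_integral => t _; congr g; apply: eq_from_tnth => i.
  rewrite tnth_mktuple; case: (unliftP ord0 i) => [j ->|->]; last by rewrite !tnth0.
  by rewrite !tnthS tnth_mktuple.
under [in RHS]eq_integral do rewrite step.
rewrite exprS EFinM -muleA -ge0_integralZl//; last 3 first.
- apply: (measurableT_comp (f := fun y => \int[mpow m n]_t g [tuple of y :: [tuple phi i.+1 (tnth t i) | i < n]])) => //.
  apply: (@measurable_fun_fubini_tonelli_F _ _ _ _ R (mpow m n)
    (fun p : T * n.-tuple T => g [tuple of p.1 :: [tuple phi i.+1 (tnth p.2 i) | i < n]])) => //.
  apply: measurableT_comp => //; apply: measurable_cons => //.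
  apply: (measurableT_comp (mtmap n (fun i => phi i.+1) (fun i => mphi i.+1))) => //.
- by move=> x _; apply: integral_ge0.
- by rewrite lee_fin exprn_ge0.
rewrite (phiK 0%N)//; last 2 first.
- exact: measurable_integral_cons.
- by move=> x; apply: integral_ge0.
congr (_ * _); apply: eq_integral => x _.
rewrite (IH (fun i => phi i.+1))//.
  by move=> i; exact: phiK.
exact: measurable_fun_cons_l.
Qed.

(** One coordinate is integrated at a time; the hypothesis on [nu] is the change of
variables that a density provides. *)
Lemma integral_mpow_density m nu (f : T -> R) :
  measurable_fun setT f -> (forall x, 0 <= f x)%R ->
  (forall g : T -> \bar R, measurable_fun setT g -> (forall x, 0 <= g x) ->
     \int[nu]_x g x = \int[m]_x (g x * (f x)%:E)) ->
  forall n (g : n.-tuple T -> \bar R), measurable_fun setT g -> (forall t, 0 <= g t) ->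
  \int[mpow nu n]_t g t =
  \int[mpow m n]_t (g t * (\prod_(i < n) f (tnth t i))%:E).
Proof.
move=> mf f0 nuf; have mprod n : measurable_fun setT
    (fun t : n.-tuple T => \prod_(i < n) f (tnth t i))%R.
  apply: measurable_prod => i _; apply: measurableT_comp => //; exact: measurable_tnth.
elim=> [|n IH] g mg g0.
  rewrite !integral_mpow0 ?big_ord0 ?mule1//.
  by apply: emeasurable_funM => //; apply/measurable_EFinP; exact: mprod.
rewrite integral_mpowS// nuf//; last 2 first.
- exact: measurable_integral_cons.
- by move=> x; apply: integral_ge0.
rewrite integral_mpowS//; last 2 first.
- by apply: emeasurable_funM => //; apply/measurable_EFinP; exact: mprod.
- by move=> t; rewrite mule_ge0// lee_fin prodr_ge0.
apply: eq_integral => x _; rewrite IH//; last exact: measurable_fun_cons_l.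
rewrite -ge0_integralZr//.
- apply: eq_integral => t _; rewrite -muleA -EFinM; congr (_ * _%:E).
  rewrite big_ord_recl tnth0 mulrC; congr (_ * _)%R.
  by apply: eq_bigr => i _; rewrite tnthS.
- apply: emeasurable_funM; first exact: measurable_fun_cons_l.
  apply/measurable_EFinP; exact: mprod.
- by move=> t _; rewrite mule_ge0// lee_fin prodr_ge0.
- by rewrite lee_fin.
Qed.

End mpow_integral.

Section density.
Local Open Scope ereal_scope.
Context {disp : measure_display} {T : measurableType disp} {R : realType}.

(** A density is almost everywhere the Radon-Nikodym derivative, for which the formula
is known. *)
Lemma integral_density (m : {sigma_finite_measure set T -> \bar R})
    (nu : {finite_measure set T -> \bar R}) (f : T -> R) :
  measurable_fun setT f -> (forall x, 0 <= f x)%R ->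
  (forall A, measurable A -> nu A = \int[m]_(x in A) (f x)%:E) ->
  forall g : T -> \bar R, measurable_fun setT g -> (forall x, 0 <= g x) ->
  \int[nu]_x g x = \int[m]_x (g x * (f x)%:E).
Proof.
move=> mf f0 nuf g mg g0.
have num : nu `<< m.
  apply/null_content_dominatesP => A mA mA0; rewrite nuf//.
  by apply: null_set_integral => //; exact/measurable_EFinP/measurable_funTS.
rewrite -(Radon_Nikodym_SigmaFinite.change_of_variables num)//.
set h := Radon_Nikodym_SigmaFinite.f nu m.
have hi : m.-integrable setT h by exact: Radon_Nikodym_SigmaFinite.f_integrable.
have mh : measurable_fun setT h by exact: measurable_int hi.
have h0 x : 0 <= h x by exact: Radon_Nikodym_SigmaFinite.f_ge0.
apply: ge0_ae_eq_integral => //.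
- exact: emeasurable_funM.
- by apply: emeasurable_funM => //; exact/measurable_EFinP.
- by move=> x _; rewrite mule_ge0.
- by move=> x _; rewrite mule_ge0// lee_fin.
apply: ae_eqe_mul2l; apply: integral_ae_eq => //; first exact/measurable_EFinP.
by move=> E _ mE; rewrite -nuf// -Radon_Nikodym_SigmaFinite.f_integral.
Qed.

End density.

Section affine.
Local Open Scope ereal_scope.
Context {R : realType}.
Local Notation leb := (@lebesgue_measure R).

(** The image of [s] times the Lebesgue measure under the affine map agrees with the
Lebesgue measure on half-open intervals, hence everywhere. *)
Lemma integral_affine (s a : R) (g : measurableTypeR R -> \bar R) : (0 < s)%R ->
  measurable_fun setT g -> (forall x, 0 <= g x) ->
  \int[leb]_x g x = s%:E * \int[leb]_x g (s * x + a)%R.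
Proof.
move=> s0 mg g0; pose phi (x : measurableTypeR R) : measurableTypeR R := (s * x + a)%R.
have mphi : measurable_fun setT phi.
  by apply: measurable_funD => //; exact: measurable_funM.
pose s' : {nonneg R} := NngNum (ltW s0).
have lebE A : measurable A -> leb A = mscale s' (pushforward leb phi) A.
  apply: lebesgue_measure_unique => X /ocitvP[->|[[u v] /= uv ->]].
    by rewrite !measure0.
  have preE : phi @^-1` `]u, v]%classic = `]((u - a) / s)%R, ((v - a) / s)%R]%classic.
    apply/seteqP; split=> x /=; rewrite !in_itv/= /phi ltr_pdivrMr// ler_pdivlMr//.
      by rewrite ltrBlDr lerBrDr [(x * s)%R]mulrC.
    by rewrite ltrBlDr lerBrDr [(x * s)%R]mulrC.
  change (leb `]u, v]%classic = s%:E * leb (phi @^-1` `]u, v]%classic)); rewrite preE.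
  rewrite !lebesgue_measure_itv/= !lte_fin uv ltr_pM2r ?invr_gt0// ltrD2r uv.
  by rewrite -EFinB -EFinM -mulrBl opprD addrACA subrr addr0 mulrC divfK// gt_eqF.
rewrite (eq_measure_integral (mscale s' (pushforward leb phi))); last first.
  by move=> A mA _; exact: lebE.
rewrite ge0_integral_mscale//= ge0_integral_pushforward//.
Qed.

Definition affine d (s : R) (a x : d.-tuple R) : d.-tuple R :=
  [tuple s * tnth x i + tnth a i | i < d]%R.

Lemma measurable_affine d (s : R) (a : d.-tuple R) :
  measurable_fun setT (affine s a : d.-tuple (measurableTypeR R) -> d.-tuple (measurableTypeR R)).
Proof.
apply/measurable_fun_tnthP => i.
rewrite (_ : _ \o _ = (fun u => s * u + tnth a i)%R \o (fun t => tnth t i)).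
  apply: measurableT_comp; last exact: measurable_tnth.
  by apply: measurable_funD => //; exact: measurable_funM.
by apply/funext => t /=; rewrite tnth_mktuple.
Qed.

Lemma integral_Rd_affine d (s : R) (a : d.-tuple R)
    (g : d.-tuple (measurableTypeR R) -> \bar R) : (0 < s)%R ->
  measurable_fun setT g -> (forall x, 0 <= g x) ->
  \int[lebesgue_Rd d]_x g x = (s ^+ d)%:E * \int[lebesgue_Rd d]_x g (affine s a x).
Proof.
move=> s0 mg g0.
rewrite (@integral_mpow_map _ _ _ leb (fun i x => s * x + nth 0 a i)%R s)//.
- congr (_ * _); apply: eq_integral => x _; congr g; apply: eq_from_tnth => i.
  by rewrite !tnth_mktuple (tnth_nth 0%R a).
- exact: ltW.
- by move=> i; apply: measurable_funD => //; exact: measurable_funM.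
- by move=> i h mh h0; exact: integral_affine.
Qed.

End affine.

(** * Measurability and similarities of Euclidean space *)

Section measurability.
Context {R : realType}.

Lemma measurable_natr_bool d (T : measurableType d) (b : T -> bool) :
  measurable_fun setT b -> measurable_fun setT (fun x => (b x)%:R : R).
Proof.
move=> mb; rewrite (_ : (fun _ => _) = (fun c : bool => c%:R : R) \o b)//.
exact: measurableT_comp.
Qed.

Lemma measurable_set_bool dd (U : measurableType dd) (b : U -> bool) :
  measurable_fun setT b -> measurable [set x | b x].
Proof.
by move=> mb; rewrite -[X in measurable X]setTI; exact: (mb measurableT [set true]).
Qed.

Lemma measurable_forall dd (U : measurableType dd) (I : finType) (b : I -> U -> bool) :
  (forall i, measurable_fun setT (b i)) ->
  measurable_fun setT (fun u => [forall i, b i u]).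
Proof.
move=> mb; rewrite (_ : (fun _ => _) = (fun u => \big[andb/true]_i b i u)); last first.
  by apply/funext => u; rewrite big_andE.
elim: (index_enum I) => [|i s IH].
  by under eq_fun do rewrite big_nil; exact: measurable_cst.
by under eq_fun do rewrite big_cons; exact: measurable_and.
Qed.

Context {d : nat}.
Local Notation T := (d.-tuple (measurableTypeR R)).

Lemma measurable_edist dd (U : measurableType dd) (f g : U -> T) :
  measurable_fun setT f -> measurable_fun setT g ->
  measurable_fun setT (fun u => edist (f u) (g u) : R).
Proof.
move=> mf mg; rewrite (_ : (fun _ => _) =
    (fun u => (\sum_(i < d) (tnth (f u) i - tnth (g u) i) ^+ 2) `^ 2^-1)); last first.
  apply/funext => u; rewrite /edist powR12_sqrt// sumr_ge0// => i _; exact: sqr_ge0.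
apply: (measurableT_comp (measurable_powR _)).
apply: measurable_sum => i; apply: measurable_funX; apply: measurable_funB.
  exact: (measurableT_comp (measurable_tnth i) mf).
exact: (measurableT_comp (measurable_tnth i) mg).
Qed.

Lemma measurable_enorm : measurable_fun setT (fun x : T => enorm x : R).
Proof. by apply: (@measurable_edist _ T id (cst (@origin R d))). Qed.

Lemma measurable_power_law (c alpha : R) :
  measurable_fun setT (fun x : T => power_law c alpha x : R).
Proof.
rewrite (_ : (fun _ => _) = (fun x : T => c * (1 + enorm x `^ alpha) `^ (-1))).
  apply: measurable_funM => //; apply: (measurableT_comp (measurable_powR _)).
  apply: measurable_funD => //; apply: (measurableT_comp (measurable_powR _)).
  exact: measurable_enorm.
by apply/funext => x; rewrite /power_law powR_inv1// addr_ge0// powR_ge0.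
Qed.

End measurability.

Section affine_norm.
Context {R : realType} {d : nat}.
Implicit Types (x y z : d.-tuple R).

Lemma enormE x : enorm x = Num.sqrt (\sum_(i < d) tnth x i ^+ 2).
Proof.
by congr Num.sqrt; apply: eq_bigr => i _; rewrite tnth_mktuple subr0.
Qed.

Lemma enorm_ge0 x : 0 <= enorm x.
Proof. exact: edist_ge0. Qed.

Lemma edist_affine (s : R) z x y : 0 <= s ->
  edist (affine s z x) (affine s z y) = s * edist x y.
Proof.
move=> s0; rewrite /edist -[in RHS](ger0_norm s0) -sqrtr_sqr -sqrtrM ?sqr_ge0//.
congr Num.sqrt; rewrite mulr_sumr; apply: eq_bigr => i _.
by rewrite !tnth_mktuple opprD addrACA subrr addr0 -mulrBr exprMn.
Qed.

Lemma affine_origin (s : R) z : affine s z (origin : d.-tuple R) = z.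
Proof. by apply: eq_from_tnth => i; rewrite !tnth_mktuple mulr0 add0r. Qed.

Lemma enorm_scale (s : R) x : 0 <= s -> enorm (affine s origin x) = s * enorm x.
Proof. by move=> s0; rewrite /enorm -(edist_affine origin)// affine_origin. Qed.

Lemma edist_translate x y : edist (affine 1 x y) x = enorm y.
Proof. by rewrite -[X in edist _ X](affine_origin 1 x) edist_affine// mul1r. Qed.

Lemma enorm_edist x y : enorm x <= enorm y + edist x y.
Proof. by rewrite addrC; exact: edist_triangle. Qed.

End affine_norm.

Section powR_limits.
Context {R : realType}.

(** The derivative of the power function at 1. *)
Lemma powR_quotient_cvg (a : R) : h^-1 * ((1 + h) `^ a - 1) @[h --> 0^'] --> a.
Proof.
have := is_derive1_powR a (@ltr01 R) => -[der val].
have := der; rewrite /derivable => /cvg_ex[l lP].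
have al : a = l by move: val; rewrite powR1 mulr1 => <-; apply/cvg_lim.
rewrite -al in lP.
apply: cvg_trans lP; apply: near_eq_cvg; near=> h.
by rewrite /= powR1 /GRing.scale/= mulr1 [h + 1]addrC.
Unshelve. all: by end_near. Qed.

Lemma powR_at1 (a : R) : x `^ a @[x --> (1 : R)] --> (1 : R).
Proof.
have c1 : {for 1, continuous (fun x : R => x `^ a)}.
  by apply/differentiable_continuous/derivable1_diffP; apply: ex_derive; exact: is_derive1_powR.
have e1 : 1 `^ a = 1 :> R by rewrite powR1.
by rewrite -[X in _ --> X]e1; exact: c1.
Qed.

Lemma powR_cvg1 (a : R) : (1 + h) `^ a @[h --> 0^'+] --> (1 : R).
Proof.
apply: (@cvg_comp _ _ _ (fun h : R => 1 + h) (fun x : R => x `^ a) _ (nbhs (1 : R))).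
  apply: cvg_at_right_filter; rewrite -[X in _ --> X]addr0.
  by apply: cvgD; [exact: cvg_cst|exact: cvg_id].
exact: powR_at1.
Qed.

End powR_limits.

(** * Ball volumes and tail integrals *)

Section volumes.
Context {R : realType} (d : nat).
Local Notation T := (d.-tuple (measurableTypeR R)).
Local Notation leb := (@lebesgue_Rd R d).

Lemma integral_natr_bool dd (U : measurableType dd) (m : {measure set U -> \bar R})
    (b : U -> bool) : measurable_fun setT b ->
  (\int[m]_x ((b x)%:R : R)%:E)%E = m [set x | b x].
Proof.
move=> mb; have mA : measurable [set x | b x].
  by rewrite -[X in measurable X]setTI; exact: (mb measurableT [set true]).
rewrite -[in RHS](setIT [set x | b x]) -integral_indic//.
apply: eq_integral => x _; rewrite indicE (_ : (x \in _) = b x)//.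
by apply/idP/idP; rewrite inE.
Qed.

Lemma measurable_enorm_le (t : R) : measurable_fun setT (fun x : T => enorm x <= t).
Proof. by apply: measurable_fun_ler => //; exact: measurable_enorm. Qed.

Lemma measurable_enorm_gt (t : R) : measurable_fun setT (fun x : T => t < enorm x).
Proof. by apply: measurable_fun_ltr => //; exact: measurable_enorm. Qed.

Lemma measurable_enorm_lt (t : R) : measurable_fun setT (fun x : T => enorm x < t).
Proof. by apply: measurable_fun_ltr => //; exact: measurable_enorm. Qed.

Definition ball_volume : \bar R := leb [set x : T | enorm x <= 1].

(** Scaling by [t] maps the unit ball to this one. *)
Lemma measure_ball (t : R) : 0 < t ->
  leb [set x : T | enorm x <= t] = ((t ^+ d)%:E * ball_volume)%E.
Proof.
move=> t0; rewrite /ball_volume -(integral_natr_bool leb (measurable_enorm_le t)) -(integral_natr_bool leb (measurable_enorm_le 1)).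
rewrite (integral_Rd_affine (@origin R d) t0).
- congr (_ * _)%E; apply: eq_integral => x _.
  by rewrite (enorm_scale _ (ltW t0)) -{2}[t]mulr1 ler_pM2l.
- by apply/measurable_EFinP; apply: measurable_natr_bool; exact: measurable_enorm_le.
- by move=> x; rewrite lee_fin.
Qed.

Lemma measure_open_ball (t : R) : 0 < t ->
  leb [set x : T | enorm x < t] = ((t ^+ d)%:E * leb [set x : T | (enorm x < 1)%R])%E.
Proof.
move=> t0; rewrite -(integral_natr_bool leb (measurable_enorm_lt t)) -(integral_natr_bool leb (measurable_enorm_lt 1)).
rewrite (integral_Rd_affine (@origin R d) t0).
- congr (_ * _)%E; apply: eq_integral => x _.
  by rewrite (enorm_scale _ (ltW t0)) -{2}[t]mulr1 ltr_pM2l.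
- by apply/measurable_EFinP; apply: measurable_natr_bool; exact: measurable_enorm_lt.
- by move=> x; rewrite lee_fin.
Qed.

Definition tail_integral (beta s : R) : \bar R :=
  (\int[leb]_x ((s < enorm x)%R%:R * enorm x `^ (- beta))%:E)%E.

Lemma measurable_tail beta s : measurable_fun setT
  (fun x : T => (s < enorm x)%R%:R * enorm x `^ (- beta)).
Proof.
apply: measurable_funM; first by apply: measurable_natr_bool; exact: measurable_enorm_gt.
by apply: (measurableT_comp (measurable_powR _)); exact: measurable_enorm.
Qed.

Lemma tail_integral_ge0 beta s : (0 <= tail_integral beta s)%E.
Proof. by apply: integral_ge0 => x _; rewrite lee_fin mulr_ge0// powR_ge0. Qed.

(** The integrand is homogeneous, so a change of scale reduces every radius to 1. *)
Lemma tail_integral_scale beta s : 0 < s ->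
  tail_integral beta s = ((s `^ (d%:R - beta))%:E * tail_integral beta 1)%E.
Proof.
move=> s0; rewrite /tail_integral (integral_Rd_affine (@origin R d) s0); last 2 first.
- by apply/measurable_EFinP; exact: measurable_tail.
- by move=> x; rewrite lee_fin mulr_ge0// powR_ge0.
have -> : s `^ (d%:R - beta) = s ^+ d * s `^ (- beta).
  rewrite powRD; last by rewrite (gt_eqF s0) implybT.
  by rewrite powR_mulrn// ltW.
rewrite EFinM -muleA; congr (_ * _)%E.
rewrite -ge0_integralZl//.
- apply: eq_integral => x _; rewrite (enorm_scale _ (ltW s0)) powRM ?(ltW s0)//; last exact: enorm_ge0.
  by rewrite -{1}[s]mulr1 ltr_pM2l// -EFinM mulrCA.
- by apply/measurable_EFinP; exact: measurable_tail.
- by move=> x _; rewrite lee_fin mulr_ge0// powR_ge0.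
- by rewrite lee_fin powR_ge0.
Qed.

Section finiteness.
Variables (alpha c : R).
Hypothesis dalpha : d%:R < alpha.
Hypothesis c0 : 0 < c.
Hypothesis int1 : (\int[leb]_x (power_law c alpha x)%:E = 1)%E.

Let alpha0 : 0 < alpha.
Proof. exact: le_lt_trans dalpha. Qed.

Let den0 (x : T) : 0 < 1 + enorm x `^ alpha.
Proof. by rewrite ltr_wpDr// powR_ge0. Qed.

Lemma power_law_ge0 (x : T) : 0 <= power_law c alpha x.
Proof. by rewrite divr_ge0// ltW. Qed.

(** The integral of the power law is 1, and 1 inside the unit ball and
[enorm x `^ (- alpha)] outside of it are at most [2 / c] times the power law. *)
Let le_power_law (u : T -> R) : measurable_fun setT u -> (forall x, 0 <= u x) ->
  (forall x, u x <= 2 / c * power_law c alpha x) -> (\int[leb]_x (u x)%:E < +oo)%E.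
Proof.
move=> mu u0 uf; apply: (@le_lt_trans _ _ (2 / c)%:E); last exact: ltry.
rewrite -[leRHS]mule1 -int1 -ge0_integralZl//; last 3 first.
- apply/measurable_EFinP; exact: measurable_power_law.
- by move=> x _; rewrite lee_fin power_law_ge0.
- by rewrite lee_fin divr_ge0// ltW.
apply: ge0_le_integral => //.
- by move=> x _; rewrite lee_fin.
- exact/measurable_EFinP.
- by apply/measurable_EFinP; apply: measurable_funM => //; exact: measurable_power_law.
- by move=> x _; rewrite -EFinM lee_fin.
Qed.

Lemma ball_volume_lty : (ball_volume < +oo)%E.
Proof.
rewrite /ball_volume -(integral_natr_bool leb (measurable_enorm_le 1)).
apply: le_power_law => //; first by apply: measurable_natr_bool; exact: measurable_enorm_le.
move=> x; case: (leP (enorm x) 1) => x1; last first.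
  by rewrite mulr_ge0 ?power_law_ge0// divr_ge0// ltW.
rewrite /power_law mulrA divfK ?gt_eqF// ler_pdivlMr// mul1r -[X in _ <= X]/(1 + 1) lerD2l.
have e1 : 1 `^ alpha = 1 :> R by rewrite powR1.
by rewrite -[leRHS]e1 ge0_ler_powR ?nnegrE ?enorm_ge0// ltW.
Qed.

Lemma tail_integral_lty beta : alpha <= beta -> (tail_integral beta 1 < +oo)%E.
Proof.
move=> ab; apply: le_power_law; first exact: measurable_tail.
  by move=> x; rewrite mulr_ge0// powR_ge0.
move=> x; case: (ltP 1 (enorm x)) => x1; last first.
  by rewrite mul0r mulr_ge0 ?power_law_ge0// divr_ge0// ltW.
have x0 : 0 < enorm x by exact: lt_trans x1.
rewrite mul1r /power_law mulrA divfK ?gt_eqF// ler_pdivlMr// powRN mulrC ler_pdivrMr ?powR_gt0//.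
apply: (@le_trans _ _ (enorm x `^ alpha *+ 2)).
  rewrite mulr2n lerD2r -(powRr0 (enorm x)); apply: ler_powR; exact: ltW.
by rewrite mulr2n mulrDl mul1r lerD// ler_powR// ltW.
Qed.

End finiteness.
End volumes.

(** * Radial integrals and the area of the sphere *)

Section radial.
Context {R : realType} (d : nat).
Local Notation T := (d.-tuple (measurableTypeR R)).
Local Notation leb := (@lebesgue_Rd R d).
Variables (alpha c : R).
Hypothesis dalpha : d%:R < alpha.
Hypothesis c0 : 0 < c.
Hypothesis int1 : (\int[leb]_x (power_law c alpha x)%:E = 1)%E.

Let w := fine (ball_volume d : \bar R).

Lemma ball_volumeE : ball_volume d = w%:E :> \bar R.
Proof. by rewrite /w fineK// ge0_fin_numE// (ball_volume_lty dalpha c0 int1). Qed.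

Let w0 : 0 <= w. Proof. by rewrite fine_ge0// measure_ge0. Qed.

Let ballE (t : R) : 0 < t -> leb [set x : T | enorm x <= t] = (t ^+ d * w)%:E.
Proof. by move=> t0; rewrite measure_ball// ball_volumeE EFinM. Qed.

Definition in_shell (s t : R) (x : T) := (s < enorm x) && (enorm x <= t).

Lemma measurable_in_shell s t : measurable_fun setT (in_shell s t).
Proof.
by apply: measurable_and; [exact: measurable_enorm_gt|exact: measurable_enorm_le].
Qed.

Lemma measure_shell (t : R) : 1 <= t ->
  leb [set x : T | in_shell 1 t x] = ((t ^+ d - 1) * w)%:E.
Proof.
move=> t1; have t0 : 0 < t by exact: lt_le_trans t1.
have e : leb [set x : T | enorm x <= t] =
    (leb [set x : T | (enorm x <= 1)%R] + leb [set x : T | in_shell 1 t x])%E.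
  rewrite -(integral_natr_bool leb (measurable_enorm_le t)).
  rewrite -(integral_natr_bool leb (measurable_enorm_le 1)).
  rewrite -(integral_natr_bool leb (measurable_in_shell 1 t)) -ge0_integralD//.
  - apply: eq_integral => x _; rewrite -EFinD -natrD; congr (_%:R%:E).
    rewrite /in_shell; case: (leP (enorm x) 1) => x1 /=.
      by rewrite (le_trans x1 t1).
    by [].
  - by apply/measurable_EFinP; apply: measurable_natr_bool; exact: measurable_enorm_le.
  - by apply/measurable_EFinP; apply: measurable_natr_bool; exact: measurable_in_shell.
move: e; rewrite !ballE// expr1n mul1r => e.
have : leb [set x : T | in_shell 1 t x] \is a fin_num.
  rewrite ge0_fin_numE//; apply: (@le_lt_trans _ _ (t ^+ d * w)%:E); last exact: ltry.
  by rewrite e leeDr// lee_fin.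
move: e; case: (leb _) => [r| |]//= [e] _.
by congr EFin; rewrite mulrBl mul1r e; ring.
Qed.

(** Scaling shows that the shell between the radii 1 and [t] carries the fraction
[1 - t ^ (d - beta)] of the tail integral, while the integrand varies there between
[t ^ (- beta)] and 1 on a volume [(t ^ d - 1) w]. Dividing by [t - 1] and letting [t]
tend to 1 determines the integral without polar coordinates. *)
Lemma tail_integralE (beta : R) : alpha <= beta ->
  tail_integral d beta 1 = (d%:R / (beta - d%:R) * w)%:E.
Proof.
move=> ab; have bd : d%:R < beta by exact: lt_le_trans ab.
have := tail_integral_lty dalpha c0 int1 ab.
rewrite -ge0_fin_numE ?tail_integral_ge0// => /fineK/esym.
set I := fine _ => tI.
pose shell t := (\int[leb]_x ((in_shell 1 t x)%:R * enorm x `^ (- beta))%:E)%E.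
have mshell t : measurable_fun setT (fun x : T => (in_shell 1 t x)%:R * enorm x `^ (- beta)).
  apply: measurable_funM; first by apply: measurable_natr_bool; exact: measurable_in_shell.
  by apply: (measurableT_comp (measurable_powR _)); exact: measurable_enorm.
have b0 : 0 <= beta by rewrite ltW// (le_lt_trans _ bd).
have split_tail t : 1 <= t -> (I * (1 - t `^ (d%:R - beta)))%:E = shell t.
  move=> t1; have t0 : 0 < t by exact: lt_le_trans t1.
  have e : tail_integral d beta 1 = (shell t + tail_integral d beta t)%E.
    rewrite /tail_integral /shell -ge0_integralD//.
    - apply: eq_integral => x _; rewrite -EFinD -mulrDl -natrD; congr (_%:R * _)%:E.
      rewrite /in_shell; case: (leP (enorm x) t) => xt; first by rewrite andbT addn0.
      by rewrite andbF (le_lt_trans t1 xt).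
    - by move=> x _; rewrite lee_fin mulr_ge0// powR_ge0.
    - exact/measurable_EFinP.
    - by move=> x _; rewrite lee_fin mulr_ge0// powR_ge0.
    - by apply/measurable_EFinP; exact: measurable_tail.
  move: e; rewrite (tail_integral_scale _ _ t0) tI.
  case: (shell t) => [r| |]//= [e].
  by rewrite mulrBr mulr1 {1}e; congr EFin; rewrite [I * _]mulrC addrK.
have shell_ub t : 1 <= t -> (shell t <= ((t ^+ d - 1) * w)%:E)%E.
  move=> t1; rewrite -measure_shell// -(integral_natr_bool leb (measurable_in_shell 1 t)).
  apply: ge0_le_integral => //.
  - by move=> x _; rewrite lee_fin mulr_ge0// powR_ge0.
  - exact/measurable_EFinP.
  - by apply/measurable_EFinP; apply: measurable_natr_bool; exact: measurable_in_shell.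
  move=> x _; rewrite lee_fin; case: (boolP (in_shell 1 t x)) => [/andP[x1 _]|]; last by rewrite mul0r.
  rewrite mul1r powRN invf_le1 ?powR_gt0 ?(lt_trans _ x1)//.
  by rewrite -(powRr0 (enorm x)) ler_powR// ltW.
have shell_lb t : 1 <= t -> ((t `^ (- beta) * ((t ^+ d - 1) * w))%:E <= shell t)%E.
  move=> t1; have t0 : 0 < t by exact: lt_le_trans t1.
  rewrite EFinM -measure_shell// -(integral_natr_bool leb (measurable_in_shell 1 t)).
  rewrite -ge0_integralZl//; last 2 first.
  - by apply/measurable_EFinP; apply: measurable_natr_bool; exact: measurable_in_shell.
  - by rewrite lee_fin powR_ge0.
  apply: ge0_le_integral => //.
  - by move=> x _; rewrite -EFinM lee_fin mulr_ge0// powR_ge0.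
  - apply/measurable_EFinP; apply: measurable_funM => //.
    by apply: measurable_natr_bool; exact: measurable_in_shell.
  - exact/measurable_EFinP.
  move=> x _; rewrite -EFinM lee_fin; case: (boolP (in_shell 1 t x)) => [/andP[x1 xt]|]; last by rewrite mul0r mulr0.
  have x0 : 0 < enorm x by exact: lt_trans x1.
  rewrite mul1r mulr1 !powRN lef_pV2 ?posrE ?powR_gt0//.
  by rewrite ge0_ler_powR// nnegrE ltW.
have Dright (a : R) : h^-1 * ((1 + h) `^ a - 1) @[h --> 0^'+] --> a.
  by apply: cvg_dnbhs_at_right; exact: powR_quotient_cvg.
have mid : I * - (h^-1 * ((1 + h) `^ (d%:R - beta) - 1)) @[h --> 0^'+] --> I * - (d%:R - beta).
  by apply: cvgM; [exact: cvg_cst|apply: cvgN].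
have upper : h^-1 * ((1 + h) `^ d%:R - 1) * w @[h --> 0^'+] --> d%:R * w.
  by apply: cvgM; [exact: Dright|exact: cvg_cst].
have lower : (1 + h) `^ (- beta) * (h^-1 * ((1 + h) `^ d%:R - 1) * w) @[h --> 0^'+] --> 1 * (d%:R * w).
  by apply: cvgM; [exact: powR_cvg1|].
have le1 : I * - (d%:R - beta) <= d%:R * w.
  apply: (ler_cvg_to mid upper); near=> h.
  have h0 : 0 < h by near: h; exact: nbhs_right_gt.
  have t1 : 1 <= 1 + h by rewrite lerDl ltW.
  have := shell_ub _ t1; rewrite -split_tail// lee_fin => le.
  rewrite powR_mulrn ?(le_trans _ t1)// -mulrN opprB -mulrA mulrCA ler_pM2l ?invr_gt0//.
have le2 : d%:R * w <= I * - (d%:R - beta).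
  rewrite -[leLHS]mul1r; apply: (ler_cvg_to lower mid); near=> h.
  have h0 : 0 < h by near: h; exact: nbhs_right_gt.
  have t1 : 1 <= 1 + h by rewrite lerDl ltW.
  have := shell_lb _ t1; rewrite -split_tail// lee_fin => le.
  rewrite powR_mulrn ?(le_trans _ t1)// -mulrN opprB -mulrA mulrCA [leRHS]mulrCA ler_pM2l ?invr_gt0//.
have bd0 : beta - d%:R != 0 by rewrite gt_eqF// subr_gt0.
rewrite opprB in le1 le2.
have e : I * (beta - d%:R) = d%:R * w by apply/eqP; rewrite eq_le le1 le2.
rewrite tI; congr EFin; apply: (mulIf bd0).
by rewrite e mulrAC divfK.
Unshelve. all: by end_near. Qed.

(** By scaling, the open ball contains closed balls of volume arbitrarily close to [w];
in particular the sphere is negligible. *)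
Lemma measure_open_unit_ball : leb [set x : T | (enorm x < 1)%R] = w%:E.
Proof.
apply/eqP; rewrite eq_le; apply/andP; split.
  rewrite -ball_volumeE; apply: le_measure; rewrite ?inE.
  - exact: measurable_set_bool (measurable_enorm_lt 1).
  - exact: measurable_set_bool (measurable_enorm_le 1).
  - by move=> x /= /ltW.
have tw : (1 - h) ^+ d * w @[h --> 0^'+] --> (1 - 0) ^+ d * w.
  apply: cvg_at_right_filter; apply: cvgM; last exact: cvg_cst.
  apply: (@cvg_comp _ _ _ (fun h : R => 1 - h) (fun x : R => x ^+ d) _ (nbhs (1 - 0 : R))).
    by apply: cvgB; [exact: cvg_cst|exact: cvg_id].
  exact: exprn_continuous.
rewrite subr0 expr1n mul1r in tw.
case e : (leb _) => [r| |]//.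
  rewrite lee_fin; apply: (cvgr_to_le tw); near=> h.
  have h0 : 0 < h by near: h; exact: nbhs_right_gt.
  have h1 : h < 1 by near: h; exact: nbhs_right_lt.
  rewrite -lee_fin -e -ballE ?subr_gt0//; apply: le_measure; rewrite ?inE.
  - exact: measurable_set_bool (measurable_enorm_le (1 - h)).
  - exact: measurable_set_bool (measurable_enorm_lt 1).
  - by move=> x /= /le_lt_trans; apply; rewrite ltrBlDr ltrDl.
  by rewrite leey.
have : (0 <= leb [set x : T | (enorm x < 1)%R])%E by exact: measure_ge0.
by rewrite e leNgt ltNy0.
Unshelve. all: by end_near. Qed.

(** A point is moved to the sphere along its ray. *)
Lemma tube_sphere (h : R) : 0 < h < 1 ->
  tube [set x : d.-tuple R | enorm x = 1] h =
  [set x | 1 - h <= enorm x <= 1 + h].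
Proof.
move=> /andP[h0 h1]; apply/seteqP; split=> [x [y /= y1 yx]|x /= /andP[lx xu]].
  apply/andP; split; last by rewrite -y1 (le_trans (enorm_edist x y))// lerD2l.
  by rewrite lerBlDr -y1 (le_trans (enorm_edist y x))// lerD2l edistC.
have x0 : 0 < enorm x by rewrite (lt_le_trans _ lx)// subr_gt0.
have [a aE] : exists a, a = (enorm x)^-1 by exists (enorm x)^-1.
have a0 : 0 <= a by rewrite aE invr_ge0 ltW.
exists (affine a origin x) => /=.
  by rewrite enorm_scale// aE mulVf// gt_eqF.
rewrite /eball/=; have -> : edist x (affine a origin x) = `|1 - a| * enorm x.
  rewrite [in RHS]enormE /edist -sqrtr_sqr -sqrtrM ?sqr_ge0//; congr Num.sqrt.
  rewrite mulr_sumr; apply: eq_bigr => i _; rewrite !tnth_mktuple addr0.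
  by rewrite -exprMn mulrBl mul1r.
rewrite -(ger0_norm (enorm_ge0 x)) -normrM mulrBl mul1r aE mulVf ?gt_eqF//.
by rewrite ler_norml; apply/andP; split; lra.
Qed.

(** The tube around the sphere is a difference of two balls, so the content is half the
sum of the right and left derivatives of [t ^ d] at 1. *)
Lemma sphere_areaE : sphere_area d = (d%:R * w)%:E :> \bar R.
Proof.
rewrite /sphere_area /surface_area; apply/cvg_lim => //.
have right : h^-1 * ((1 + h) `^ d%:R - 1) @[h --> 0^'+] --> (d%:R : R).
  by apply: cvg_dnbhs_at_right; exact: powR_quotient_cvg.
have left : (- h)^-1 * ((1 - h) `^ d%:R - 1) @[h --> 0^'+] --> (d%:R : R).
  have : h^-1 * ((1 + h) `^ d%:R - 1) @[h --> 0^'-] --> (d%:R : R).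
    by apply: cvg_dnbhs_at_left; exact: powR_quotient_cvg.
  by move=> /cvg_at_leftNP; rewrite oppr0.
have key : ((h^-1 * ((1 + h) `^ d%:R - 1) + (- h)^-1 * ((1 - h) `^ d%:R - 1)) * (w / 2))%:E
    @[h --> 0^'+] --> ((d%:R + d%:R) * (w / 2))%:E.
  apply: cvg_EFin; first by near=> h.
  by apply: cvgM; [exact: cvgD|exact: cvg_cst].
rewrite (_ : d%:R * w = (d%:R + d%:R) * (w / 2)); last by field.
apply: cvg_trans key; apply: near_eq_cvg; near=> h.
have h0 : 0 < h by near: h; exact: nbhs_right_gt.
have h1 : h < 1 by near: h; exact: nbhs_right_lt.
rewrite tube_sphere ?h0//.
have -> : leb [set x : T | 1 - h <= enorm x <= 1 + h] =
    (((1 + h) ^+ d - (1 - h) ^+ d) * w)%:E.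
  have e : leb [set x : T | enorm x <= 1 + h] =
    (leb [set x : T | (enorm x < 1 - h)%R] + leb [set x : T | (1 - h <= enorm x <= 1 + h)%R])%E.
    rewrite -measureU.
    - congr (leb _); apply/seteqP; split=> [x /= xh|x /= [/ltW xh|/andP[]//]].
        by case: (ltP (enorm x) (1 - h)) => xh'; [left|right; apply/andP].
      by apply: (le_trans xh); lra.
    - exact: measurable_set_bool (measurable_enorm_lt (1 - h)).
    - have mb : measurable_fun setT (fun x : T => 1 - h <= enorm x <= 1 + h).
        apply: measurable_and; last exact: measurable_enorm_le.
        by apply: measurable_fun_ler => //; exact: measurable_enorm.
      exact: measurable_set_bool mb.
    - by apply/seteqP; split=> x //= [xh /andP[hx _]]; move: (lt_le_trans xh hx); rewrite ltxx.
  move: e; rewrite ballE ?addr_gt0// measure_open_ball ?subr_gt0// measure_open_unit_ball -EFinM.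
  case: (leb _) => [r| |]//= [e].
  by congr EFin; rewrite mulrBl e; ring.
rewrite -EFinM !powR_mulrn ?subr_ge0 ?addr_ge0 ?ltW//; congr EFin.
by field; rewrite gt_eqF.
Unshelve. all: by end_near. Qed.

End radial.

(** * Measurability of the hollow configurations *)

Section common_point.
Context {R : realType} {d : nat}.
Implicit Types (p x y : d.-tuple R).

Lemma edist_le_coord x y (e : R) : 0 <= e ->
  (forall i, `|tnth x i - tnth y i| <= e / d.+1%:R) -> edist x y <= e.
Proof.
move=> e0 h; rewrite -(ger0_norm e0) -sqrtr_sqr ler_wsqrtr//.
apply: (@le_trans _ _ (\sum_(i < d) (e / d.+1%:R) ^+ 2)).
  by apply: ler_sum => i _; rewrite -real_normK ?num_real// lerXn2r// nnegrE// divr_ge0.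
rewrite sumr_const card_ord -[leLHS]mulr_natr expr_div_n -mulrA ler_piMr ?sqr_ge0//.
rewrite mulrC ler_pdivrMr ?exprn_gt0// mul1r -natrX ler_nat.
by rewrite (leq_trans (leqnSn d))// -[X in (X <= _)%N]expn1 leq_pexp2l.
Qed.

Lemma coord_le_edist x y i : `|tnth x i - tnth y i| <= edist x y.
Proof.
rewrite -sqrtr_sqr ler_wsqrtr// (bigD1 i)//= lerDl sumr_ge0// => j _.
exact: sqr_ge0.
Qed.

Definition rat_point (q : d.-tuple rat) : d.-tuple R := [tuple ratr (tnth q i) | i < d].

Lemma rat_point_dense p (e : R) : 0 < e -> exists q, edist (rat_point q) p <= e.
Proof.
move=> e0; have : 0 < e / d.+1%:R by rewrite divr_gt0.
move: (e / d.+1%:R) (fun q => @edist_le_coord q p _ (ltW e0)) => de le_coord de0.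
have /choice[q qP] : forall i, exists q : rat, `|ratr q - tnth p i| <= de.
  move=> i; have [|q] := @rat_in_itvoo R (tnth p i - de) (tnth p i + de).
    by lra.
  rewrite in_itv/= => /andP[q1 q2]; exists q; rewrite ler_norml; apply/andP; split; lra.
exists [tuple q i | i < d]; apply: le_coord.
by move=> i; rewrite !tnth_mktuple.
Qed.

(** Points that lie almost in all the balls stay in a box, and a cluster point of them
lies in all the balls because these are closed. *)
Lemma common_at_compact (J : finType) (x : J -> d.-tuple R) (I : {set J}) :
  (forall n : nat, exists p, forall i, i \in I -> edist p (x i) <= 1 + n.+1%:R^-1) ->
  common_at x I.
Proof.
have [->|/finset.set0Pn[i0 i0I]] := eqVneq I finset.set0.
  by move=> _; exists origin => i; rewrite inE.
move=> /choice[p pP].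
pose v n : 'rV[R]_d := \row_i tnth (p n) i.
pose K := [set u : 'rV[R]_d | forall i, `[tnth (x i0) i - 2, tnth (x i0) i + 2]%classic (u ord0 i)].
have cK : compact K.
  apply: (@rV_compact _ _ (fun i => `[tnth (x i0) i - 2, tnth (x i0) i + 2]%classic)).
  by move=> i; exact: segment_compact.
have vK n : K (v n).
  move=> i /=; rewrite in_itv/= mxE.
  have := le_trans (coord_le_edist (p n) (x i0) i) (pP n _ i0I).
  have n1 : n.+1%:R^-1 <= 1 :> R by rewrite invf_le1 ?ler1n.
  move: n1; move: (n.+1%:R^-1) => a a1.
  by rewrite ler_norml => /andP[l u]; apply/andP; split; lra.
have [|u [_ uc]] := cK (v @ \oo) _; first by exists 0%N => // n _; exact: vK.
exists [tuple u ord0 i | i < d] => i iI.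
apply/ler_addgt0Pr => e e0.
pose de := e / 2 / d.+1%:R.
have de0 : 0 < de by rewrite divr_gt0// divr_gt0.
have [N N1] : exists N, N.+1%:R^-1 <= e / 2.
  exists (Num.truncn (e / 2)^-1).
  rewrite -[leRHS]invrK lef_pV2 ?posrE ?invr_gt0 ?divr_gt0//.
  by rewrite ltW// truncnS_gt.
have [||w [wN wu]] := uc [set w | exists2 n, (N <= n)%N & w = v n] (ball u de).
- by exists N => // n /= Nn; exists n.
- exact: nbhsx_ballx.
case: wN => n Nn wE.
rewrite (_ : 1 + e = e / 2 + (1 + e / 2)); last by lra.
apply: (edist_triangle_le (y := p n)).
  apply: edist_le_coord => [|j]; first by rewrite divr_ge0// ltW.
  have [_ /(_ ord0 j)] := wu.
  by rewrite wE mxE tnth_mktuple /ball/= => /ltW.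
apply: (le_trans (pP n i iI)); rewrite lerD2l (le_trans _ N1)//.
by rewrite lef_pV2 ?posrE// ler_nat ltnS.
Qed.

End common_point.

Section hollow_measurable.
Context {R : realType} {d : nat}.
Local Notation T := (d.-tuple (measurableTypeR R)).

(** The existence of a common point is a statement about a continuum of candidates. With
a slack it can be tested on rational points, and by compactness all slacks together imply
the statement without slack. *)
Lemma measurable_common_at m (I : {set 'I_m}) :
  measurable [set t : m.-tuple T | common_at (tnth t : 'I_m -> d.-tuple R) I].
Proof.
pose F n (q : d.-tuple rat) (i : 'I_m) : set (m.-tuple T) :=
  [set t | (edist (rat_point q) (tnth t i) <= 1 + n.+1%:R^-1 :> R)].
rewrite (_ : [set _ | _] = \bigcap_n \bigcup_q \bigcap_(i in [set` I]) F n q i).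
  apply: bigcap_measurableType => n _.
  apply: countable_bigcupT_measurable; first exact: countableP.
  move=> q.
  apply: fin_bigcap_measurable; first exact: finite_finset.
  move=> i _; apply: (@measurable_set_bool _ _ (fun t : m.-tuple T => edist (rat_point q) (tnth t i) <= 1 + n.+1%:R^-1 :> R)).
  apply: measurable_fun_ler => //; apply: (@measurable_edist _ d) => //.
  exact: measurable_tnth.
apply/seteqP; split=> t /=.
  move=> [p pP] n _; have n0 : 0 < n.+1%:R^-1 :> R by rewrite invr_gt0.
  have [q qp] := rat_point_dense p n0; exists q => // i iI /=.
  by rewrite /F/= addrC; apply: edist_triangle_le qp _; exact: pP.
move=> h; apply: common_at_compact => n; have [q _ qP] := h n Logic.I.
by exists (rat_point q) => i iI; exact: (qP i iI).
Qed.

Lemma measurable_hollow_tuple k :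
  measurable [set t : k.+2.-tuple T | hollow_tuple (t : k.+2.-tuple (d.-tuple R))].
Proof.
rewrite (_ : [set _ | _] =
  (\bigcap_(i in [set: 'I_k.+2]) [set t : k.+2.-tuple T | common_at (tnth t : _ -> d.-tuple R) ([set: 'I_k.+2] :\ i)%SET]) `&`
  ~` [set t : k.+2.-tuple T | common_at (tnth t : _ -> d.-tuple R) [set: 'I_k.+2]%SET]).
  apply: measurableI; last by apply: measurableC; exact: measurable_common_at.
  apply: fin_bigcap_measurable; first exact: finite_finset.
  by move=> i _; exact: measurable_common_at.
apply/seteqP; split=> t.
  by move=> [_ cf nI]; split => // i _; apply: cf; rewrite inE.
by move=> [cf nI]; split => //; [rewrite cardsT card_ord|move=> i _; exact: (cf i)].
Qed.

Lemma hollow_tuple_translate k (x : d.-tuple R) (t : k.+2.-tuple (d.-tuple R)) :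
  hollow_tuple [tuple affine 1 x (tnth t i) | i < k.+2] <-> hollow_tuple t.
Proof.
have ct (I : {set 'I_k.+2}) (z : d.-tuple R) (u : k.+2.-tuple (d.-tuple R)) :
    common_at (tnth u) I -> common_at (tnth [tuple affine 1 z (tnth u i) | i < k.+2]) I.
  move=> [p pP]; exists (affine 1 z p) => i iI.
  by rewrite tnth_mktuple edist_affine// mul1r pP.
pose nx : d.-tuple R := [tuple - tnth x i | i < d].
have tK : [tuple affine 1 nx (tnth [tuple affine 1 x (tnth t i) | i < k.+2] i) | i < k.+2] = t.
  apply: eq_from_tnth => i; rewrite !tnth_mktuple; apply: eq_from_tnth => j.
  by rewrite !tnth_mktuple !mul1r addrK.
have cE I : common_at (tnth [tuple affine 1 x (tnth t i) | i < k.+2]) I <-> common_at (tnth t) I.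
  by split=> [/(ct _ nx)|]; [rewrite tK|exact: ct].
split=> -[cI cf nI]; split => //.
- by move=> i iI; apply/cE; exact: cf.
- by move=> /cE.
- by move=> i iI; apply/cE; exact: cf.
- by move=> /cE.
Qed.

End hollow_measurable.

(** * Joint laws of subsamples *)

Section boxes.
Local Open Scope ereal_scope.
Context {disp : measure_display} {T : measurableType disp} {R : realType}.

Definition tuple_box n (B : nat -> set T) : set (n.-tuple T) :=
  [set t | forall i : 'I_n, B i (tnth t i)].

Arguments tuple_box n B : clear implicits.

Lemma measurable_tuple_box n B : (forall i, measurable (B i)) -> measurable (tuple_box n B).
Proof.
move=> mB; rewrite (_ : tuple_box n B =
    \bigcap_(i in [set: 'I_n]) ((fun t => tnth t i) @^-1` B i)).
  apply: fin_bigcap_measurable; first exact: finite_finset.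
  by move=> i _; rewrite -[X in measurable X]setTI; apply: measurable_tnth.
by apply/seteqP; split=> t h i => [_|]; exact: h.
Qed.

Lemma mpow_tuple_box (m : {sigma_finite_measure set T -> \bar R}) n (B : nat -> set T) :
  (forall i, measurable (B i)) ->
  mpow m n (tuple_box n B) = \prod_(i < n) m (B i).
Proof.
elim: n B => [|n IH] B mB.
  by rewrite big_ord0 /= diracE mem_set// => -[].
rewrite big_ord_recl -(IH (fun i => B i.+1))// /= /mcons /pushforward.
rewrite (_ : _ @^-1` _ = B 0%N `*` tuple_box n (fun i => B i.+1)).
  by rewrite product_measure1E//; exact: measurable_tuple_box.
apply/seteqP; split=> -[x t] /=.
  move=> h; split; first by have := h ord0; rewrite tnth0.
  by move=> i; have := h (lift ord0 i); rewrite tnthS.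
move=> [x0 h] i; case: (unliftP ord0 i) => [j ->|->]; last by rewrite tnth0.
by rewrite tnthS; exact: h.
Qed.

Lemma mpow_setT (m : probability T R) n : mpow m n setT = 1.
Proof.
have -> : [set: n.-tuple T] = tuple_box n (fun=> setT) by apply/seteqP.
by rewrite mpow_tuple_box// big1// => i _; exact: probability_setT.
Qed.

(** Boxes are stable under intersection and generate the product sigma-algebra. *)
Lemma tuple_measure_unique n (m1 m2 : {measure set (n.-tuple T) -> \bar R}) :
  (m1 setT < +oo) ->
  (forall B, (forall i, measurable (B i)) -> m1 (tuple_box n B) = m2 (tuple_box n B)) ->
  forall A, measurable A -> m1 A = m2 A.
Proof.
move=> m1oo m12; pose G := [set tuple_box n B | B in [set B | forall i, measurable (B i)]].
have GT : G setT by exists (fun=> setT) => //; apply/seteqP.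
apply: (measure_unique G (fun=> setT)) => //.
- apply/seteqP; split.
    apply: smallest_sub; first exact: smallest_sigma_algebra.
    move=> A; rewrite -bigcup_seq => -[i _ [B mB <-]]; apply: sub_sigma_algebra.
    exists (fun j => if j == i :> nat then B else setT).
      by move=> j /=; case: ifP.
    rewrite setTI; apply/seteqP; split=> t /=.
      by move=> h; have := h i; rewrite eqxx.
    by move=> Bt j; case: eqP => // /val_inj->.
  apply: smallest_sub; first exact: sigma_algebra_measurable.
  by move=> _ [B mB <-]; exact: measurable_tuple_box.
- move=> _ _ [B mB <-] [C mC <-]; exists (fun i => B i `&` C i).
    by move=> i; exact: measurableI.
  apply/seteqP; split=> t; first by move=> h; split=> i; have [] := h i.
  by move=> [hB hC] i; split; [exact: hB|exact: hC].
- by rewrite bigcup_const.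
- by move=> _ [B mB <-]; exact: m12.
Qed.

End boxes.

Section joint_law.
Local Open Scope ereal_scope.
Context {disp disp' : measure_display} {Omega : measurableType disp}
  {T : measurableType disp'} {R : realType} {P : probability Omega R}.
Variable X : nat -> {RV P >-> T}.
Hypothesis Xind : mutually_independent X.
Hypothesis Xid : forall i A, measurable A ->
  distribution P (X i) A = distribution P (X 0%N) A.

Let law : probability T R := distribution P (X 0%N).

Definition subsample m (e : nat -> nat) (w : Omega) : m.-tuple T := [tuple X (e i) w | i < m].

Lemma measurable_subsample m e : measurable_fun setT (subsample m e).
Proof.
apply/measurable_fun_tnthP => i; rewrite (_ : _ \o _ = X (e i)); first exact: measurable_funPT.
by apply/funext => w /=; rewrite tnth_mktuple.
Qed.

(** Mutual independence gives the probabilities of boxes, which determine the law. *)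
Lemma subsample_law m e : {in gtn m &, injective e} ->
  forall A, measurable A -> P (subsample m e @^-1` A) = mpow law m A.
Proof.
move=> einj.
pose sub : {mfun Omega >-> m.-tuple T} := HB.pack (subsample m e)
  (isMeasurableFun.Build _ _ _ _ _ (@measurable_subsample m e)).
apply: (@tuple_measure_unique _ _ _ _ (distribution P sub)).
  by rewrite [X in X < _](@probability_setT _ _ _ (distribution P sub)) ltry.
move=> B mB; apply: eq_trans (esym (@mpow_tuple_box _ _ _ law m B mB)).
pose s := [seq e i | i <- iota 0 m].
have us : uniq s.
  rewrite map_inj_in_uniq ?iota_uniq// => i j; rewrite !mem_iota !add0n => im jm.
  exact: einj.
pose J := [fset x | x in s]%fset; pose A x := B (index x s).
have AE i : (i < m)%N -> A (e i) = B i.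
  move=> im; rewrite /A (_ : e i = nth (e 0%N) s i); first by rewrite index_uniq// size_map size_iota.
  by rewrite (nth_map 0%N) ?size_iota// nth_iota.
have := Xind J (A := A) (fun i => mB _).
rewrite (perm_big s)/=; last first.
  by apply: uniq_perm; [exact: fset_uniq|exact: us|move=> x; rewrite !inE].
have iotaE : iota 0 m = index_iota 0 m by rewrite /index_iota subn0.
rewrite big_map iotaE big_mkord => PJ.
transitivity (P (\bigcap_(i in [set` J]) X i @^-1` A i)).
  rewrite /distribution /pushforward; congr (P _); apply/seteqP; split=> w /= h.
    move=> j /=; rewrite !inE => /mapP[i]; rewrite mem_iota add0n => im ->.
    by rewrite /= AE//; have := h (Ordinal im); rewrite tnth_mktuple.
  move=> i; rewrite tnth_mktuple -AE//; apply: (h (e i)).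
  by rewrite /= !inE; apply: map_f; rewrite mem_iota add0n ltn_ord.
rewrite PJ; apply: eq_bigr => i _; rewrite AE//; exact: (Xid (e i) (mB i)).
Qed.

End joint_law.

(** * Probability of a cluster far from the origin *)

Section monotone_integral.
Local Open Scope ereal_scope.
Context {dd : measure_display} {U : measurableType dd} {R : realType}.

(** The integral of a nonnegative function is a supremum over simple functions below
it, hence monotone. This form compares Betti numbers and inner integrals directly with
measurable functions. *)
Lemma ge0_le_integral_any (m : {measure set U -> \bar R}) (f g : U -> \bar R) :
  (forall x, 0 <= f x) -> (forall x, f x <= g x) ->
  \int[m]_x f x <= \int[m]_x g x.
Proof.
move=> f0 fg; have g0 x : 0 <= g x by exact: le_trans (fg x).
rewrite !ge0_integralE//; apply: le_ereal_sup => _ [h hf <-].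
exists h => // x; apply: (le_trans (hf x)).
by rewrite !patch_setT.
Qed.

End monotone_integral.

Section cluster_probability.
Context {R : realType} (d : nat).
Local Notation T := (d.-tuple (measurableTypeR R)).
Local Notation leb := (@lebesgue_Rd R d).
Variables (alpha c : R).
Hypothesis dalpha : d%:R < alpha.
Hypothesis c0 : 0 < c.
Hypothesis int1 : (\int[leb]_x (power_law c alpha x)%:E = 1)%E.
Variable nu : probability T R.
Hypothesis nuE : forall A, measurable A -> nu A = (\int[leb]_(x in A) (power_law c alpha x)%:E)%E.

Local Notation f := (@power_law R d c alpha).

Let alpha0 : 0 < alpha.
Proof. exact: le_lt_trans dalpha. Qed.

Let f_ge0 (x : T) : 0 <= f x.
Proof. exact: (power_law_ge0 alpha c0). Qed.

Let mf : measurable_fun setT (fun x : T => f x).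
Proof. exact: measurable_power_law. Qed.

Let nu_density (g : T -> \bar R) : measurable_fun setT g -> (forall x, (0 <= g x)%E) ->
  (\int[nu]_x g x = \int[leb]_x (g x * (f x)%:E))%E.
Proof. exact: integral_density. Qed.

Definition translate l (x : T) (y : l.-tuple T) : l.-tuple T :=
  [tuple affine 1 x (tnth y i) | i < l].

(** The predicate [h] singles out configurations of [l.+1] points by their shape: it is
invariant under translations and confines the points to a ball of radius [rho] about the
first one. *)
Variables (l : nat) (h : l.+1.-tuple T -> bool) (rho : R).
Hypothesis mh : measurable_fun setT h.
Hypothesis h_translate : forall x t, h (translate x t) = h t.
Hypothesis rho0 : 0 <= rho.
Hypothesis h_near : forall t i, h t -> edist (tnth t ord0) (tnth t i) <= rho.

Let h0 (y : l.-tuple T) := h [tuple of (@origin R d : T) :: y].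

Let mh0 : measurable_fun setT h0.
Proof.
apply: (@measurableT_comp _ _ _ _ _ _ h) => //.
exact: (@measurable_cons _ _ _ T (cst (@origin R d)) l id).
Qed.

Definition shape_integral : \bar R := (\int[mpow leb l]_y ((h0 y)%:R : R)%:E)%E.

Definition cluster_prob (r : R) : \bar R :=
  mpow nu l.+1 [set t | h t && [forall i, r < enorm (tnth t i)]].

Let h0_near (x : T) (y : l.-tuple T) (i : 'I_l.+1) : h0 y ->
  edist (tnth [tuple of x :: translate x y] i) x <= rho.
Proof.
move=> hy; move: (h_near i hy); rewrite tnth0; case: (unliftP ord0 i) => [j ->|-> _].
  by rewrite !tnthS tnth_mktuple edist_translate edistC.
by rewrite tnth0 edistxx.
Qed.

Lemma shape_integral_ge0 : (0 <= shape_integral)%E.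
Proof. by apply: integral_ge0 => y _; rewrite lee_fin. Qed.

(** The product density is bounded below on the bounded set of admissible shapes, and
its integral is at most 1. *)
Lemma shape_integral_lty : (shape_integral < +oo)%E.
Proof.
pose k := 1 + rho `^ alpha; have k0 : 0 < k by rewrite ltr_wpDr// powR_ge0.
have fk (y : T) : enorm y <= rho -> c / k <= f y.
  move=> yr; rewrite ler_pM2l// lef_pV2 ?posrE ?ltr_wpDr ?powR_ge0//.
  by rewrite lerD2l ge0_ler_powR ?nnegrE ?enorm_ge0// ltW.
have ck : 0 < c / k by rewrite divr_gt0.
apply: (@le_lt_trans _ _ ((c / k) ^- l)%:E); last exact: ltry.
apply: (@le_trans _ _ (\int[mpow leb l]_y
   (((c / k) ^- l)%:E * (((h0 y)%:R : R)%:E * (\prod_(i < l) f (tnth y i))%:E)))%E).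
  apply: ge0_le_integral_any => y; first by rewrite lee_fin.
  rewrite -!EFinM lee_fin; case: (boolP (h0 y)) => hy; last by rewrite mul0r mulr0.
  rewrite mul1r mulrC ler_pdivlMr ?exprn_gt0// mul1r.
  rewrite -{1}[l]card_ord -prodr_const; apply: ler_prod => i _; rewrite ltW//=.
  apply: fk; have := h0_near (@origin R d) (lift ord0 i) hy.
  by rewrite tnthS tnth_mktuple edist_translate.
have mhE : measurable_fun setT (fun y : l.-tuple T => ((h0 y)%:R : R)%:E).
  by apply/measurable_EFinP; exact: measurable_natr_bool.
rewrite ge0_integralZl//; last 3 first.
- apply: emeasurable_funM => //; apply/measurable_EFinP; apply: measurable_prod => i _.
  by apply: measurableT_comp => //; exact: measurable_tnth.
- by move=> y _; rewrite -EFinM lee_fin mulr_ge0// prodr_ge0.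
- by rewrite lee_fin invr_ge0 exprn_ge0// ltW.
rewrite -(@integral_mpow_density _ _ _ leb nu f)//.
rewrite -[leRHS]mule1; apply: lee_wpmul2l; first by rewrite lee_fin invr_ge0 exprn_ge0// ltW.
rewrite integral_natr_bool// -(mpow_setT nu l); apply: le_measure; rewrite ?inE//.
exact: measurable_set_bool.
Qed.

Let g (r : R) (x : T) : R := (r < enorm x)%R%:R * f x.

Let mg r : measurable_fun setT (g r).
Proof.
apply: measurable_funM => //; apply: measurable_natr_bool; exact: measurable_enorm_gt.
Qed.

Let g_ge0 r x : 0 <= g r x. Proof. by rewrite mulr_ge0. Qed.

Let F (r : R) (x : T) (y : l.-tuple T) : R :=
  (h0 y)%:R * \prod_(i < l.+1) g r (tnth [tuple of x :: translate x y] i).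

Let F_ge0 r x y : 0 <= F r x y.
Proof. by rewrite mulr_ge0// prodr_ge0. Qed.

Lemma measurable_outside (r : R) : measurable_fun setT
  (fun t : l.+1.-tuple T => [forall i, r < enorm (tnth t i)]).
Proof.
apply: measurable_forall => i.
apply: (measurableT_comp (measurable_enorm_gt r)); exact: measurable_tnth.
Qed.

Lemma measurable_cluster (r : R) : measurable_fun setT
  (fun t : l.+1.-tuple T => h t && [forall i, r < enorm (tnth t i)]).
Proof. by apply: measurable_and => //; exact: measurable_outside. Qed.

(** The points other than the first are expressed relative to it, so that the shape and
the position of the configuration become separate variables. *)
Lemma cluster_probE r : cluster_prob r = (\int[leb]_x \int[mpow leb l]_y (F r x y)%:E)%E.
Proof.
rewrite /cluster_prob -integral_natr_bool; last exact: measurable_cluster.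
rewrite (@integral_mpow_density _ _ _ leb nu f)//; last first.
  by apply/measurable_EFinP; apply: measurable_natr_bool; exact: measurable_cluster.
pose G (t : l.+1.-tuple T) : R := (h t)%:R * \prod_(i < l.+1) g r (tnth t i).
have mG : measurable_fun setT G.
  apply: measurable_funM; first exact: measurable_natr_bool.
  apply: measurable_prod => i _; apply: measurableT_comp => //; exact: measurable_tnth.
have G0 t : 0 <= G t by rewrite mulr_ge0// prodr_ge0.
transitivity (\int[mpow leb l.+1]_t (G t)%:E)%E.
  apply: eq_integral => t _; rewrite -EFinM; congr EFin; rewrite /G /g [in RHS]big_split/= mulrA.
  congr (_ * _); case: (h t); rewrite ?mul0r// andTb mul1r.
  case: forallP => [rt|nrt]; first by rewrite big1// => i _; rewrite rt.
  case: (pickP (fun i => ~~ (r < enorm (tnth t i)))) => [i ri|all].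
    by rewrite (bigD1 i)//= (negbTE ri) mul0r.
  by case: nrt => i; have /negbFE := all i.
rewrite (@integral_mpowS _ _ _ leb l (fun t => (G t)%:E)); last 2 first.
- exact/measurable_EFinP.
- by move=> t; rewrite lee_fin.
apply: eq_integral => x _.
rewrite (@integral_mpow_map _ _ _ leb (fun=> affine 1 x) 1)//; last 4 first.
- by move=> _; exact: measurable_affine.
- by move=> _ g' mg' g'0; rewrite (integral_Rd_affine x (@ltr01 R))// expr1n.
- apply: (measurable_fun_cons_l (g := fun t => (G t)%:E) x); exact/measurable_EFinP.
- by move=> t; rewrite lee_fin.
rewrite expr1n mul1e; apply: eq_integral => y _; congr EFin; rewrite /G /F.
congr (_%:R * _); rewrite /h0 -(h_translate x [tuple of _ :: y]); congr h.
apply: eq_from_tnth => i; rewrite [RHS]tnth_mktuple.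
case: (unliftP ord0 i) => [j ->|->]; last by rewrite !tnth0 affine_origin.
by rewrite !tnthS tnth_mktuple.
Qed.

Let beta := alpha * l.+1%:R.

Let integral_scaled_tail (U r : R) : 0 <= U ->
  (\int[leb]_x \int[mpow leb l]_y
     ((h0 y)%:R * (((r < enorm x)%R%:R * enorm x `^ (- beta)) * U))%:E =
   U%:E * shape_integral * tail_integral d beta r)%E.
Proof.
move=> U0; have mhE : measurable_fun setT (fun y : l.-tuple T => ((h0 y)%:R : R)%:E).
  by apply/measurable_EFinP; exact: measurable_natr_bool.
pose A (x : T) : R := (r < enorm x)%R%:R * enorm x `^ (- beta).
have A0 x : 0 <= A x by rewrite mulr_ge0// powR_ge0.
have mA : measurable_fun setT (fun x => (A x)%:E) by apply/measurable_EFinP; exact: measurable_tail.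
transitivity (\int[leb]_x (shape_integral * U%:E * (A x)%:E))%E.
  apply: eq_integral => x _; rewrite -muleA -EFinM mulrC -/(A x).
  rewrite -ge0_integralZr//; last by rewrite lee_fin mulr_ge0.
rewrite ge0_integralZl//; first by rewrite [(U%:E * _)%E]muleC.
  by move=> x _; rewrite lee_fin.
by rewrite mule_ge0// shape_integral_ge0.
Qed.

Let pow_beta (x : T) : enorm x `^ (- beta) = (enorm x `^ (- alpha)) ^+ l.+1.
Proof. by rewrite -powR_mulrn ?powR_ge0// -powRrM mulNr. Qed.

(** All points of the cluster have norm at least [enorm x * (1 - rho / r)], where [x] is
the first one, so each density is at most a constant times [enorm x ^ (- alpha)]; shape
and position then separate. *)
Lemma cluster_prob_ub r : rho < r ->
  (cluster_prob r <= ((c * (1 - rho / r) `^ (- alpha)) ^+ l.+1)%:E * shape_integral *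
     tail_integral d beta r)%E.
Proof.
move=> rr; have r0 : 0 < r by exact: le_lt_trans rr.
have q0 : 0 < 1 - rho / r by rewrite subr_gt0 ltr_pdivrMr// mul1r.
set u := c * _; have u0 : 0 <= u by rewrite mulr_ge0 ?powR_ge0// ltW.
rewrite cluster_probE -integral_scaled_tail ?exprn_ge0//.
apply: ge0_le_integral_any => x; first by apply: integral_ge0 => y _; rewrite lee_fin.
apply: ge0_le_integral_any => y; first by rewrite lee_fin.
rewrite lee_fin /F; case: (boolP (h0 y)) => hy; last by rewrite !mul0r.
rewrite !mul1r; case: (ltP r (enorm x)) => rx; last first.
  by rewrite big_ord_recl tnth0 /g ltNge rx/= !mul0r.
rewrite mul1r pow_beta -exprMn.
have x0 : 0 < enorm x by exact: lt_trans rx.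
rewrite -[X in _ ^+ X]card_ord -prodr_const; apply: ler_prod => i _.
rewrite g_ge0/= /g; set z := tnth _ i.
have zx : edist z x <= rho by exact: h0_near.
have zE : enorm x * (1 - rho / r) <= enorm z.
  apply: (@le_trans _ _ (enorm x - rho)).
    rewrite mulrBr mulr1 lerD2l lerN2 mulrCA ler_peMr// ler_pdivlMr// mul1r ltW//.
  by rewrite lerBlDr; apply: (le_trans (enorm_edist x z)); rewrite lerD2l edistC.
have z0 : 0 < enorm z by apply: lt_le_trans zE; rewrite mulr_gt0.
apply: (@le_trans _ _ (f z)).
  by rewrite ler_piMl// lern1 leq_b1.
apply: (@le_trans _ _ (c * enorm z `^ (- alpha))).
  rewrite ler_pM2l// powRN lef_pV2 ?posrE ?powR_gt0// ?ltr_wpDr ?powR_ge0//.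
  by rewrite lerDr.
rewrite [leRHS]mulrC /u -mulrA ler_pM2l// -powRM ?(ltW q0) ?(ltW x0)//.
rewrite [_ * enorm x]mulrC !powRN lef_pV2 ?posrE ?powR_gt0 ?mulr_gt0//.
apply: ge0_ler_powR => //; rewrite ?nnegrE; [exact: ltW| |exact: ltW].
by rewrite mulr_ge0// ltW.
Qed.

(** When the first point [x] has norm above [r + rho], all the points are outside the
ball of radius [r] and have norm at most [enorm x * (1 + rho / r)]. The summand 1 in the
denominator of the density costs at most the factor with [r ^ (- alpha)]. *)
Lemma cluster_prob_lb r : rho < r ->
  (((c / (r `^ (- alpha) + (1 + rho / r) `^ alpha)) ^+ l.+1)%:E * shape_integral *
     tail_integral d beta (r + rho) <= cluster_prob r)%E.
Proof.
move=> rr; have r0 : 0 < r by exact: le_lt_trans rr.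
have q0 : 0 < 1 + rho / r by rewrite ltr_pwDl// divr_ge0// ltW.
set D := _ + _; have D0 : 0 < D by rewrite addr_gt0// powR_gt0.
have u0 : 0 <= c / D by rewrite divr_ge0// ltW.
rewrite cluster_probE -integral_scaled_tail ?exprn_ge0//.
apply: ge0_le_integral_any => x.
  by apply: integral_ge0 => y _; rewrite lee_fin !mulr_ge0 ?exprn_ge0// powR_ge0.
apply: ge0_le_integral_any => y; first by rewrite lee_fin !mulr_ge0 ?exprn_ge0// powR_ge0.
rewrite lee_fin /F; case: (boolP (h0 y)) => hy; last by rewrite !mul0r.
rewrite !mul1r; case: (ltP (r + rho) (enorm x)) => rx; last first.
  by rewrite !mul0r prodr_ge0.
have rx' : r < enorm x by apply: le_lt_trans rx; rewrite lerDl.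
have x0 : 0 < enorm x by exact: lt_trans rx'.
rewrite mul1r pow_beta -exprMn -[X in _ ^+ X]card_ord -prodr_const; apply: ler_prod => i _.
rewrite mulr_ge0 ?powR_ge0//= /g; set z := tnth _ i.
have zx : edist z x <= rho by exact: h0_near.
have rz : r < enorm z.
  rewrite -(ltrD2r rho); apply: (lt_le_trans rx).
  by apply: (le_trans (enorm_edist x z)); rewrite lerD2l edistC.
have zE : enorm z <= enorm x * (1 + rho / r).
  apply: (le_trans (enorm_edist z x)); rewrite mulrDr mulr1 lerD2l (le_trans zx)//.
  by rewrite mulrCA ler_peMr// ler_pdivlMr// mul1r ltW.
rewrite rz mul1r [leLHS]mulrC -mulrA ler_pM2l// powRN -invfM lef_pV2 ?posrE; last 2 first.
- by rewrite mulr_gt0// powR_gt0.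
- by rewrite ltr_wpDr// powR_ge0.
rewrite /D mulrDl; apply: lerD.
  rewrite powRN mulrC ler_pdivlMr ?powR_gt0// mul1r.
  by apply: ge0_ler_powR; rewrite ?nnegrE; exact: ltW.
rewrite -powRM ?(ltW q0) ?(ltW x0)// mulrC.
apply: ge0_ler_powR => //; rewrite ?nnegrE; [exact: ltW|exact: enorm_ge0|].
by rewrite mulr_ge0// ltW.
Qed.

End cluster_probability.

(** * Limit of the cluster probabilities *)

Section binomial_limit.
Context {R : realType}.

Lemma cvg_natV : (n%:R^-1 : R) @[n --> \oo] --> (0 : R).
Proof. by rewrite -(cvg_shiftS (fun n => n%:R^-1 : R)); exact: cvg_harmonic. Qed.

Lemma ffact_cvg m : ((n ^_ m)%:R / n%:R ^+ m : R) @[n --> \oo] --> (1 : R).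
Proof.
elim: m => [|m IH].
  by under eq_fun do rewrite ffactn0 expr0 divr1; exact: cvg_cst.
rewrite -[X in _ --> X]mulr1.
have lim : (1 - m%:R * n%:R^-1 : R) @[n --> \oo] --> (1 - m%:R * 0 : R).
  apply: cvgB; first exact: cvg_cst.
  by apply: cvgM; [exact: cvg_cst|exact: cvg_natV].
rewrite mulr0 subr0 in lim.
apply: cvg_trans (cvgM IH lim); apply: near_eq_cvg; near=> n.
have n0 : (0 < n)%N by near: n; exact: nbhs_infty_gt.
have mn : (m <= n)%N by near: n; exact: nbhs_infty_ge.
have n0' : n%:R != 0 :> R by rewrite pnatr_eq0 -lt0n.
rewrite /= ffactnSr natrM natrB// exprS; field.
by rewrite n0'/= expf_neq0.
Unshelve. all: by end_near. Qed.

Lemma binomial_cvg m : ('C(n, m)%:R / n%:R ^+ m : R) @[n --> \oo] --> (m`!%:R^-1 : R).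
Proof.
have f0 : m`!%:R != 0 :> R by rewrite pnatr_eq0 -lt0n fact_gt0.
rewrite -[X in _ --> X]mul1r.
rewrite (_ : (fun _ => _) = (fun n => (n ^_ m)%:R / n%:R ^+ m * m`!%:R^-1 : R)).
  by apply: cvgM; [exact: ffact_cvg|exact: cvg_cst].
by apply/funext => n; rewrite -bin_ffact natrM [RHS]mulrAC mulfK.
Qed.

End binomial_limit.

Section cluster_limit.
Context {R : realType} (d : nat).
Local Notation T := (d.-tuple (measurableTypeR R)).
Local Notation leb := (@lebesgue_Rd R d).
Variables (alpha c : R).
Hypothesis dalpha : d%:R < alpha.
Hypothesis c0 : 0 < c.
Hypothesis int1 : (\int[leb]_x (power_law c alpha x)%:E = 1)%E.
Variable nu : probability T R.
Hypothesis nuE : forall A, measurable A -> nu A = (\int[leb]_(x in A) (power_law c alpha x)%:E)%E.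
Variables (l : nat) (h : l.+1.-tuple T -> bool) (rho : R).
Hypothesis mh : measurable_fun setT h.
Hypothesis h_translate : forall x t, h (translate x t) = h t.
Hypothesis rho0 : 0 <= rho.
Hypothesis h_near : forall t i, h t -> edist (tnth t ord0) (tnth t i) <= rho.
Variable r : nat -> R.
Hypothesis r0 : forall n, 0 < r n.
Hypothesis r_alpha : r n `^ (- alpha) @[n --> \oo] --> (0 : R).

Let alpha0 : 0 < alpha.
Proof. exact: le_lt_trans dalpha. Qed.

Lemma radiusV_cvg : (r n)^-1 @[n --> \oo] --> (0 : R).
Proof.
apply/cvgrPdist_lt => e e0.
move/cvgrPdist_lt : r_alpha => /(_ (e `^ alpha) (powR_gt0 _ e0)); apply: filterS => n.
rewrite !sub0r !normrN !ger0_norm ?powR_ge0 ?invr_ge0 ?(ltW (r0 n))//.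
rewrite powRN -[X in X < _ -> _]powR_inv1 ?powR_ge0// powRAC powR_inv1 ?(ltW (r0 n))//.
by apply: contraTT; rewrite -!leNgt => le; rewrite ge0_ler_powR ?nnegrE ?invr_ge0// ltW.
Qed.

Let rho_r : rho / r n @[n --> \oo] --> (0 : R).
Proof. by rewrite -(mulr0 rho); apply: cvgM; [exact: cvg_cst|exact: radiusV_cvg]. Qed.

Let near_rho : \forall n \near \oo, rho < r n.
Proof.
move/cvgrPdist_lt : rho_r => /(_ _ ltr01); apply: filterS => n.
by rewrite sub0r normrN ger0_norm ?divr_ge0 ?(ltW (r0 n))// ltr_pdivrMr// mul1r.
Qed.

Let powR_rho (s a : R) : (1 + s * (rho / r n)) `^ a @[n --> \oo] --> (1 : R).
Proof.
have lim : (1 + s * (rho / r n)) @[n --> \oo] --> (1 + s * 0 : R).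
  apply: cvgD; first exact: cvg_cst.
  by apply: cvgM; [exact: cvg_cst|exact: rho_r].
rewrite mulr0 addr0 in lim.
exact: (cvg_comp (fun n => 1 + s * (rho / r n)) (fun x : R => x `^ a) lim (@powR_at1 R a)).
Qed.

Let beta := alpha * l.+1%:R.
Let tau := d%:R / (beta - d%:R) * fine (ball_volume d : \bar R).
Let J := fine (shape_integral h).

Let JE : shape_integral h = J%:E.
Proof.
by rewrite /J fineK// ge0_fin_numE ?shape_integral_ge0// (shape_integral_lty dalpha c0 nuE mh rho0).
Qed.

Let tailE s : 0 < s -> tail_integral d beta s = (s `^ (d%:R - beta) * tau)%:E.
Proof.
move=> s0; rewrite tail_integral_scale// (tail_integralE dalpha c0 int1) ?EFinM//.
by rewrite ler_peMr ?ler1n// ltW.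
Qed.

Lemma cluster_prob_fin s : cluster_prob nu h s \is a fin_num.
Proof.
rewrite ge0_fin_numE//; apply: (@le_lt_trans _ _ 1%E); last exact: ltry.
rewrite -(mpow_setT nu l.+1); apply: le_measure; rewrite ?inE//.
exact: measurable_set_bool (measurable_cluster mh s).
Qed.

(** Both bounds scale like [r ^ (d - alpha l.+1)], and their constants agree in the
limit since [rho / r] tends to 0. *)
Lemma cluster_prob_cvg :
  r n `^ (alpha * l.+1%:R - d%:R) * fine (cluster_prob nu h (r n)) @[n --> \oo] -->
  c ^+ l.+1 * J * tau.
Proof.
have ub : ((c * (1 - rho / r n) `^ (- alpha)) ^+ l.+1 * J * tau) @[n --> \oo] -->
    (c * 1) ^+ l.+1 * J * tau.
  apply: cvgM; last exact: cvg_cst.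
  apply: cvgM; last exact: cvg_cst.
  have lim : c * (1 - rho / r n) `^ (- alpha) @[n --> \oo] --> c * 1.
    apply: cvgM; first exact: cvg_cst.
    by under eq_fun do rewrite -mulN1r; exact: powR_rho.
  exact: (cvg_comp _ (fun x : R => x ^+ l.+1) lim (@exprn_continuous _ l.+1 (c * 1))).
have lb : (((c / (r n `^ (- alpha) + (1 + rho / r n) `^ alpha)) ^+ l.+1 * J *
    (1 + rho / r n) `^ (d%:R - beta)) * tau) @[n --> \oo] -->
    (c / (0 + 1)) ^+ l.+1 * J * 1 * tau.
  have h1 a : (1 + rho / r n) `^ a @[n --> \oo] --> (1 : R).
    by under eq_fun do rewrite -[rho / _]mul1r; exact: powR_rho.
  apply: cvgM; last exact: cvg_cst.
  apply: cvgM; last exact: h1.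
  apply: cvgM; last exact: cvg_cst.
  have lim : c / (r n `^ (- alpha) + (1 + rho / r n) `^ alpha) @[n --> \oo] --> c / (0 + 1).
    apply: cvgM; first exact: cvg_cst.
    by apply: cvgV; [rewrite add0r oner_neq0|apply: cvgD; [exact: r_alpha|exact: h1]].
  exact: (cvg_comp _ (fun x : R => x ^+ l.+1) lim (@exprn_continuous _ l.+1 (c / (0 + 1)))).
rewrite mulr1 in ub; rewrite add0r divr1 mulr1 in lb.
apply: (squeeze_cvgr _ lb ub); near=> n.
have rr : rho < r n by near: n.
have rn := r0 n.
have rD : 0 < r n + rho by rewrite ltr_wpDr.
have q0 : 0 < 1 + rho / r n by rewrite ltr_wpDr// divr_ge0// ltW.
have rP a : 0 < r n `^ a by exact: powR_gt0.
have e1 : r n `^ (beta - d%:R) * r n `^ (d%:R - beta) = 1.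
  by rewrite -powRD ?(gt_eqF rn) ?implybT// addrA subrK subrr powRr0.
have := cluster_prob_lb dalpha c0 nuE mh h_translate rho0 h_near rr.
have := cluster_prob_ub dalpha c0 nuE mh h_translate rho0 h_near rr.
rewrite -/beta !tailE// JE -[cluster_prob nu h (r n)]fineK ?cluster_prob_fin// -!EFinM !lee_fin => u lo.
apply/andP; split.
  move: lo; rewrite -(ler_pM2l (rP (beta - d%:R))); apply: le_trans.
  have -> : r n + rho = r n * (1 + rho / r n) by field; rewrite gt_eqF.
  rewrite powRM ?(ltW rn) ?(ltW q0)//; set A := (_ / _) ^+ _.
  rewrite (_ : r n `^ (beta - d%:R) * _ = (r n `^ (beta - d%:R) * r n `^ (d%:R - beta)) *
    (A * J * (1 + rho / r n) `^ (d%:R - beta) * tau)); last by ring.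
  by rewrite e1 mul1r.
move: u; rewrite -(ler_pM2l (rP (beta - d%:R))) => /le_trans; apply.
set A := (_ * _) ^+ _.
rewrite (_ : r n `^ (beta - d%:R) * _ = (r n `^ (beta - d%:R) * r n `^ (d%:R - beta)) *
    (A * J * tau)); last by ring.
by rewrite e1 mul1r.
Unshelve. all: by end_near. Qed.

End cluster_limit.

(** * Expected numbers of clusters and near tuples *)

Section expectation.
Local Open Scope ereal_scope.
Context {dd : measure_display} {U : measurableType dd} {R : realType}.
Variable m : {measure set U -> \bar R}.

Lemma card_natrE (K : finType) (b : K -> bool) :
  (#|[set k | b k]%SET|%:R = \sum_k (b k)%:R :> R)%R.
Proof.
rewrite cardE -sum1_size natr_sum big_enum_cond/= big_mkcond/=.
by apply: eq_bigr => k _; rewrite inE andbT; case: (b k).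
Qed.

Lemma measurable_card (K : finType) (b : K -> U -> bool) :
  (forall k, measurable_fun setT (b k)) ->
  measurable_fun setT (fun w => #|[set k | b k w]%SET|%:R : R).
Proof.
move=> mb; under eq_fun do rewrite card_natrE.
by apply: measurable_sum => k; exact: measurable_natr_bool.
Qed.

Lemma integral_card (K : finType) (b : K -> U -> bool) :
  (forall k, measurable_fun setT (b k)) ->
  \int[m]_w (#|[set k | b k w]%SET|%:R : R)%:E = \sum_k m [set w | b k w].
Proof.
move=> mb; under eq_integral do rewrite card_natrE -sumEFin.
rewrite ge0_integral_sum//.
- by apply: eq_bigr => k _; rewrite integral_natr_bool.
- by move=> k; apply/measurable_EFinP; exact: measurable_natr_bool.
Qed.

(** The lower bound goes through the positive part of [N - M], which is measurable and
lies below [b]. *)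
Lemma integral_squeeze (b N M : U -> R) :
  measurable_fun setT N -> measurable_fun setT M ->
  (forall w, 0 <= b w)%R -> (forall w, 0 <= N w)%R -> (forall w, 0 <= M w)%R ->
  (forall w, b w <= N w + M w)%R -> (forall w, N w <= b w + M w)%R ->
  \int[m]_w (b w)%:E <= \int[m]_w (N w)%:E + \int[m]_w (M w)%:E /\
  \int[m]_w (N w)%:E <= \int[m]_w (b w)%:E + \int[m]_w (M w)%:E.
Proof.
move=> mN mM b0 N0 M0 bN Nb.
have sumE (u v : U -> R) : measurable_fun setT u -> measurable_fun setT v ->
    (forall w, 0 <= u w)%R -> (forall w, 0 <= v w)%R ->
    \int[m]_w (u w + v w)%:E = \int[m]_w (u w)%:E + \int[m]_w (v w)%:E.
  move=> mu mv u0 v0; under eq_integral do rewrite EFinD.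
  apply: ge0_integralD => //; try exact/measurable_EFinP.
    by move=> w _; rewrite lee_fin.
  by move=> w _; rewrite lee_fin.
split.
  rewrite -sumE//; apply: ge0_le_integral_any => w; first by rewrite lee_fin.
  by rewrite lee_fin.
pose D (w : U) : R := (Num.max 0 (N w - M w))%R.
have mD : measurable_fun setT D by apply: measurable_maxr => //; exact: measurable_funB.
have D0 w : (0 <= D w)%R by rewrite le_max lexx.
apply: (@le_trans _ _ (\int[m]_w (D w)%:E + \int[m]_w (M w)%:E)).
  rewrite -sumE//; apply: ge0_le_integral_any => w; first by rewrite lee_fin.
  by rewrite lee_fin -lerBlDr le_max lexx orbT.
apply: leeD => //; apply: ge0_le_integral_any => w; first by rewrite lee_fin.
by rewrite lee_fin ge_max b0 lerBlDr Nb.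
Qed.

End expectation.

Section sampling_counts.
Context {disp : measure_display} {Omega : measurableType disp} {R : realType}
  {P : probability Omega R} {d : nat}.
Local Notation T := (d.-tuple (measurableTypeR R)).
Variable X : nat -> {RV P >-> T}.
Hypothesis Xind : mutually_independent X.
Hypothesis Xid : forall i A, measurable A ->
  distribution P (X i) A = distribution P (X 0%N) A.

Let law : probability T R := distribution P (X 0%N).

Lemma notin_eball (r : R) (x : T) : ((x : d.-tuple R) \notin eball origin r) = (r < enorm x).
Proof. by rewrite ltNge; congr negb; apply/idP/idP; rewrite inE. Qed.

Variables (l n : nat) (h : l.+1.-tuple T -> bool) (r : R).
Hypothesis mh : measurable_fun setT h.

Local Notation x w := (fun i : 'I_n => X i w : d.-tuple R).
Local Notation out w := (fun i : 'I_n => (X i w : d.-tuple R) \notin eball origin r).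

Lemma nth_enum_inj (s : seq 'I_n) m : uniq s -> size s = m ->
  {in gtn m &, injective (nth 0%N (map val s))}.
Proof.
move=> us ss i j im jm /eqP; rewrite nth_uniq ?size_map ?ss//.
  by move/eqP.
by rewrite map_inj_uniq//; exact: val_inj.
Qed.

Lemma subsample_outside m (s : seq 'I_n) w : size s = m ->
  [forall i, r < enorm (tnth (subsample X m (nth 0%N (map val s)) w) i)] = all (out w) s.
Proof.
move=> ss; apply/forallP/allP => [rt i|rt i].
  move=> /(nthP i)[j]; rewrite ss => jm <-; have := rt (Ordinal jm).
  by rewrite tnth_mktuple (nth_map i) ?ss// notin_eball.
have i0 : 'I_n.
  by case: s ss {rt} => [e|//]; exfalso; case: i => i /=; rewrite -e.
rewrite tnth_mktuple (nth_map i0) ?ss//.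
by have := rt (nth i0 s i); rewrite notin_eball; apply; rewrite mem_nth ?ss.
Qed.

Lemma prob_subsample m (q : m.-tuple T -> bool) (s : seq 'I_n) :
  measurable_fun setT q -> uniq s -> size s = m ->
  P [set w | q (subsample X m (nth 0%N (map val s)) w)] = mpow law m [set t | q t].
Proof.
move=> mq us ss; rewrite -(subsample_law Xind Xid (nth_enum_inj us ss))//.
exact: measurable_set_bool.
Qed.

(** Each of the binomially many index sets is a cluster with the same probability. *)
Lemma expected_clusters (hI : Omega -> {set 'I_n} -> Prop) :
  (forall w (I : {set 'I_n}), #|I| = l.+1 ->
     hI w I <-> h (subsample X l.+1 (nth 0%N (map val (enum I))) w)) ->
  measurable_fun setT (fun w => #|clusters (out w) l.+1 (hI w)|%:R : R) /\
  (\int[P]_w (#|clusters (out w) l.+1 (hI w)|%:R : R)%:E =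
    'C(n, l.+1)%:R%:E * cluster_prob law h r)%E.
Proof.
move=> hE; pose q (t : l.+1.-tuple T) := h t && [forall i, r < enorm (tnth t i)].
have mq : measurable_fun setT q by exact: measurable_cluster.
pose b (I : {set 'I_n}) w := (#|I| == l.+1) && q (subsample X l.+1 (nth 0%N (map val (enum I))) w).
have clE w : clusters (out w) l.+1 (hI w) = [set I | b I w]%SET.
  apply/setP => I; rewrite !inE /b; case: eqP => //= cI.
  have sI : size (enum I) = l.+1 by rewrite -cardE.
  rewrite /q subsample_outside// andbC; congr (_ && _).
    by apply/asboolP/idP => /hE; apply.
  apply/forall_inP/allP => io i; first by rewrite mem_enum; exact: io.
  by move=> iI; apply: io; rewrite mem_enum.
have mb I : measurable_fun setT (b I).
  apply: measurable_and => //; apply: measurableT_comp => //.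
  exact: measurable_subsample.
split; first by under eq_fun do rewrite clE; exact: measurable_card.
under eq_integral do rewrite clE.
rewrite integral_card// (bigID (fun I : {set 'I_n} => #|I| == l.+1))/= [X in (_ + X)%E]big1 ?adde0; last first.
  move=> I /negbTE cI; rewrite (_ : [set w | _] = set0) ?measure0//.
  by apply/seteqP; split=> w //=; rewrite /b cI.
rewrite (eq_bigr (fun=> cluster_prob law h r)); last first.
  move=> I /eqP cI; have sI : size (enum I) = l.+1 by rewrite -cardE.
  rewrite /cluster_prob -(prob_subsample mq (enum_uniq I) sI).
  by congr (P _); apply/seteqP; split=> w /=; rewrite /b cI eqxx.
have := card_draws 'I_n l.+1; rewrite card_ord => <-.
rewrite big_const cardsE; elim: #|_| => [|k IH]; first by rewrite mul0e.
rewrite iterS IH -[in RHS]add1n natrD EFinD ge0_muleDl ?lee_fin// mul1e//.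
Qed.

(** Each of the tuples without repetition is near with the same probability. *)
Lemma expected_near_tuples :
  let h6 (t : l.+1.-tuple T) := [forall i, (edist (tnth t ord0) (tnth t i) <= 6 :> R)] in
  measurable_fun setT (fun w => #|near_tuples (x w) (out w) l|%:R : R) /\
  (\int[P]_w (#|near_tuples (x w) (out w) l|%:R : R)%:E <=
    (n%:R ^+ l.+1)%:E * cluster_prob law h6 r)%E.
Proof.
move=> h6; pose q (t : l.+1.-tuple T) := h6 t && [forall i, r < enorm (tnth t i)].
have mh6 : measurable_fun setT h6.
  apply: measurable_forall => i; apply: measurable_fun_ler => //.
  by apply: measurable_edist; exact: measurable_tnth.
have mq : measurable_fun setT q by exact: measurable_cluster.
pose b (t : l.+1.-tuple 'I_n) w := uniq t && q (subsample X l.+1 (nth 0%N (map val t)) w).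
have clE w : near_tuples (x w) (out w) l = [set t | b t w]%SET.
  apply/setP => t; rewrite !inE /b; case: (uniq t) => //=.
  rewrite /q subsample_outside ?size_tuple// andbC; congr (_ && _).
  have tE i : tnth (subsample X l.+1 (nth 0%N (map val t)) w) i = X (tnth t i) w.
    by rewrite tnth_mktuple (nth_map (tnth t i)) ?size_tuple// -tnth_nth.
  apply/allP/forallP => [ta i|ta i].
    by rewrite !tE -[tnth t ord0]/(thead t); apply: ta; exact: mem_tnth.
  by move=> /tnthP[j ->]; have := ta j; rewrite !tE.
have mb t : measurable_fun setT (b t).
  apply: measurable_and => //; apply: measurableT_comp => //.
  exact: measurable_subsample.
split; first by under eq_fun do rewrite clE; exact: measurable_card.
under eq_integral do rewrite clE.
rewrite integral_card//.
apply: (@le_trans _ _ (\sum_(t : l.+1.-tuple 'I_n) cluster_prob law h6 r)%E).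
  apply: lee_sum => t _; rewrite /b; case: (boolP (uniq t)) => ut.
    by rewrite /cluster_prob -(prob_subsample mq ut (size_tuple t)) lexx.
  rewrite [X in (P X <= _)%E](_ : _ = set0); first by rewrite measure0.
  by apply/seteqP; split.
rewrite big_const card_tuple card_ord -natrX.
have Q0 : (0 <= cluster_prob law h6 r)%E by exact: measure_ge0.
elim: (n ^ l.+1)%N => [|k IH]; first by rewrite mul0e.
by rewrite iterS -[in leRHS]add1n natrD EFinD ge0_muleDl ?lee_fin// mul1e leeD2l.
Qed.

End sampling_counts.

(** * Expected Betti numbers *)

Section expected_betti.
Context {disp : measure_display} {Omega : measurableType disp} {R : realType}
  {P : probability Omega R} {d : nat}.
Local Notation T := (d.-tuple (measurableTypeR R)).
Variable X : nat -> {RV P >-> T}.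
Variables (alpha c : R) (r : nat -> R).
Hypothesis dalpha : d%:R < alpha.
Hypothesis c0 : 0 < c.
Hypothesis int1 : (\int[lebesgue_Rd d]_x (power_law c alpha x)%:E = 1)%E.
Hypothesis Xind : mutually_independent X.
Hypothesis Xdens : forall i, has_density (lebesgue_Rd d) (X i) (power_law c alpha).
Hypothesis r0 : forall n, 0 < r n.
Hypothesis nr0 : n%:R * r n `^ (- alpha) @[n --> \oo] --> (0 : R).

Local Notation x w := (fun i => X i w : d.-tuple R).
Local Notation out n w := (fun i => (X i w : d.-tuple R) \notin eball origin (r n)).

Let Xid i A : measurable A -> distribution P (X i) A = distribution P (X 0%N) A.
Proof. by move=> mA; rewrite !Xdens. Qed.

(** The hypothesis with the factor [n] is stronger for positive [n]. *)
Lemma radius_powR_cvg : r n `^ (- alpha) @[n --> \oo] --> (0 : R).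
Proof.
apply: (squeeze_cvgr _ (cvg_cst (0 : R)) nr0); near=> n.
rewrite powR_ge0/= ler_peMl ?powR_ge0// ler1n.
by near: n; exact: nbhs_infty_gt.
Unshelve. all: by end_near. Qed.

(** Clusters of [l.+1] points contribute at the scale [n ^ l.+1 r ^ (d - alpha l.+1)].
Near tuples, which have one point more, contribute at a scale that is smaller by the
factor [n r ^ (- alpha)], and this factor tends to 0 by hypothesis. *)
Lemma expectation_cvg (l : nat) (h : l.+1.-tuple T -> bool) (rho : R)
    (hI : forall n, Omega -> {set 'I_n} -> Prop) (b : nat -> Omega -> R) :
  measurable_fun setT h ->
  (forall z t, h (translate z t) = h t) -> 0 <= rho ->
  (forall t i, h t -> edist (tnth t ord0) (tnth t i) <= rho) ->
  (forall n w (I : {set 'I_n}), #|I| = l.+1 ->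
     hI n w I <-> h (subsample X l.+1 (nth 0%N (map val (enum I))) w)) ->
  (forall n w, 0 <= b n w) ->
  (forall n w, b n w <= #|@clusters n (out n w) l.+1 (hI n w)|%:R +
                        #|@near_tuples R d n (x w) (out n w) l.+1|%:R) ->
  (forall n w, #|@clusters n (out n w) l.+1 (hI n w)|%:R <=
      b n w + #|@near_tuples R d n (x w) (out n w) l.+1|%:R) ->
  (((n%:R ^+ l.+1 * r n `^ (d%:R - alpha * l.+1%:R))^-1)%:E * 'E_P[b n] @[n --> \oo] -->
   ((l.+1)`!%:R^-1 * (c ^+ l.+1 * fine (shape_integral h) *
     (d%:R / (alpha * l.+1%:R - d%:R) * fine (ball_volume d : \bar R))))%:E)%E.
Proof.
move=> mh ht rho0 hn hE b0 bN Nb.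
pose law : probability T R := distribution P (X 0%N).
have lawE A : measurable A -> law A = (\int[lebesgue_Rd d]_(x in A) (power_law c alpha x)%:E)%E.
  exact: Xdens.
pose h6 (t : l.+2.-tuple T) := [forall i, (edist (tnth t ord0) (tnth t i) <= 6 :> R)].
have mh6 : measurable_fun setT h6.
  apply: measurable_forall => i; apply: measurable_fun_ler => //.
  by apply: measurable_edist; exact: measurable_tnth.
have h6t z t : h6 (translate z t) = h6 t.
  by apply: eq_forallb => i; rewrite !tnth_mktuple edist_affine// mul1r.
have h6n t i : h6 t -> edist (tnth t ord0) (tnth t i) <= 6 by move=> /forallP.
pose q n := fine (cluster_prob law h (r n)); pose q6 n := fine (cluster_prob law h6 (r n)).
have qE n : cluster_prob law h (r n) = (q n)%:E.
  by rewrite /q fineK// (cluster_prob_fin law mh).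
have q6E n : cluster_prob law h6 (r n) = (q6 n)%:E.
  by rewrite /q6 fineK// (cluster_prob_fin law mh6).
have ra := radius_powR_cvg.
have lim := cluster_prob_cvg dalpha c0 int1 lawE mh ht rho0 hn r0 ra.
have lim6 := cluster_prob_cvg dalpha c0 int1 lawE mh6 h6t (ler0n _ 6) h6n r0 ra.
have bounds n : 'E_P[b n]%E \is a fin_num /\
    'C(n, l.+1)%:R * q n - n%:R ^+ l.+2 * q6 n <= fine 'E_P[b n]%E <=
    'C(n, l.+1)%:R * q n + n%:R ^+ l.+2 * q6 n.
  have [mN EN] := expected_clusters Xind Xid (r n) mh (hE n).
  have [mM EM] := @expected_near_tuples _ _ _ _ _ _ Xind Xid l.+1 n (r n).
  rewrite -/law -/h6 qE in EN; rewrite -/law -/h6 q6E in EM.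
  have [up lo] := integral_squeeze P mN mM (b0 n) (fun=> ler0n _ _) (fun=> ler0n _ _) (bN n) (Nb n).
  rewrite EN in up lo; rewrite -!EFinM in up lo EM.
  have bE : (\int[P]_w (b n w)%:E = 'E_P[b n])%E by rewrite unlock.
  rewrite bE in up lo.
  have up' := le_trans up (leeD2l _ EM); have lo' := le_trans lo (leeD2l _ EM).
  have Eb0 : (0 <= 'E_P[b n])%E by rewrite -bE; apply: integral_ge0 => w _; rewrite lee_fin.
  have fb : 'E_P[b n]%E \is a fin_num.
    by rewrite ge0_fin_numE// (le_lt_trans up')// -EFinD ltry.
  split => //; rewrite -(fineK fb) -EFinD !lee_fin in up' lo'.
  by rewrite lerBlDr lo'.
rewrite (_ : (fun n : nat => _) = (fun n => ((n%:R ^+ l.+1 * r n `^ (d%:R - alpha * l.+1%:R))^-1 *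
    fine 'E_P[b n]%E)%:E)); last first.
  by apply/funext => n; rewrite EFinM fineK//; exact: (bounds n).1.
apply: cvg_EFin; first exact: nearW.
pose u n := 'C(n, l.+1)%:R / n%:R ^+ l.+1 * (r n `^ (alpha * l.+1%:R - d%:R) * q n).
pose v n := n%:R * r n `^ (- alpha) * (r n `^ (alpha * l.+2%:R - d%:R) * q6 n).
have ulim : u n @[n --> \oo] --> (l.+1)`!%:R^-1 * (c ^+ l.+1 * fine (shape_integral h) *
     (d%:R / (alpha * l.+1%:R - d%:R) * fine (ball_volume d : \bar R))).
  by apply: cvgM; [exact: binomial_cvg|exact: lim].
have vlim : v n @[n --> \oo] --> (0 : R).
  by rewrite -[X in _ --> X](mul0r (c ^+ l.+2 * fine (shape_integral h6) *
     (d%:R / (alpha * l.+2%:R - d%:R) * fine (ball_volume d : \bar R)))); apply: cvgM.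
have lo := cvgB ulim vlim; have up := cvgD ulim vlim.
rewrite subr0 in lo; rewrite addr0 in up.
apply: (squeeze_cvgr (f := fun n => u n - v n) (h := fun n => u n + v n)); [|exact: lo|exact: up].
near=> n.
have n0 : (0 < n)%N by near: n; exact: nbhs_infty_gt.
have n0' : 0 < n%:R :> R by rewrite ltr0n.
have rn a : 0 < r n `^ a by exact: powR_gt0.
have [_ /andP[lo' up']] := bounds n.
have A0 : 0 < (n%:R ^+ l.+1 * r n `^ (d%:R - alpha * l.+1%:R))^-1.
  by rewrite invr_gt0 mulr_gt0// exprn_gt0.
have rV : (r n `^ (d%:R - alpha * l.+1%:R))^-1 = r n `^ (alpha * l.+1%:R - d%:R).
  by rewrite -powRN opprB.
have uE : u n = (n%:R ^+ l.+1 * r n `^ (d%:R - alpha * l.+1%:R))^-1 * ('C(n, l.+1)%:R * q n).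
  by rewrite /u invfM rV; ring.
have vE : v n = (n%:R ^+ l.+1 * r n `^ (d%:R - alpha * l.+1%:R))^-1 * (n%:R ^+ l.+2 * q6 n).
  rewrite /v invfM rV.
  have -> : r n `^ (alpha * l.+1%:R - d%:R) = r n `^ (- alpha) * r n `^ (alpha * l.+2%:R - d%:R).
    rewrite -powRD ?(gt_eqF (r0 n)) ?implybT//; congr powR.
    by rewrite -[l.+2]addn1 natrD mulrDr mulr1; ring.
  rewrite [n%:R ^+ l.+2]exprS; field; by rewrite expf_neq0// gt_eqF.
by rewrite uE vE -mulrBr -mulrDr !ler_pM2l// lo' up'.
Unshelve. all: by end_near. Qed.

End expected_betti.

Section betti_counts.
Context {disp : measure_display} {Omega : measurableType disp} {R : realType}
  {P : probability Omega R} {d : nat}.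
Local Notation T := (d.-tuple (measurableTypeR R)).
Variable X : nat -> {RV P >-> T}.

Lemma mem_outer_sample (s : R) n w (p : d.-tuple R) :
  p \in [fset y in sample X n w | y \notin eball origin s]%fset <->
  exists2 i : 'I_n, (X i w : d.-tuple R) \notin eball origin s & p = X i w.
Proof.
rewrite !inE /=; split=> [/andP[/imfsetP[i /=]]|[i oi ->]].
  by rewrite mem_iota add0n => im -> oi; exists (Ordinal im).
rewrite oi andbT; apply/imfsetP; exists (i : nat) => //=.
by rewrite mem_iota add0n ltn_ord.
Qed.

Lemma hollow_at_subsample k n w (I : {set 'I_n}) : #|I| = k.+2 ->
  hollow_at (fun i : 'I_n => X i w : d.-tuple R) k I <->
  hollow_tuple (subsample X k.+2 (nth 0%N (map val (enum I))) w : k.+2.-tuple (d.-tuple R)).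
Proof.
move=> cI; have sI : size (enum I) = k.+2 by rewrite -cardE.
have /card_gt0P[i0 i0I] : (0 < #|I|)%N by rewrite cI.
pose g (j : 'I_k.+2) := nth i0 (enum I) j.
have ginj : {in [set: 'I_k.+2]%SET &, injective g}.
  move=> i j _ _ /eqP; rewrite nth_uniq ?enum_uniq ?sI//.
  by move=> /eqP/val_inj.
have gI : (g @: [set: 'I_k.+2])%SET = I.
  apply/setP => i; apply/imsetP/idP => [[j _ ->]|iI].
    by rewrite -mem_enum mem_nth// sI.
  have := iI; rewrite -mem_enum => /(nthP i0)[j]; rewrite sI => jk <-.
  by exists (Ordinal jk).
rewrite -{1}gI; apply: hollow_at_imset => // j _.
by rewrite tnth_mktuple (nth_map i0) ?sI.
Qed.

End betti_counts.

Theorem theorem2p2 (R : realType) (d : nat) (alpha c : R)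
    (disp : measure_display) (Omega : measurableType disp)
    (P : probability Omega R)
    (X : nat -> {RV P >-> d.-tuple (measurableTypeR R)}) (r : nat -> R) :
  (1 <= d)%N -> d%:R < alpha ->
  0 < c -> (\int[lebesgue_Rd d]_x (power_law c alpha x)%:E = 1)%E ->
  mutually_independent X ->
  (forall i, has_density (lebesgue_Rd d) (X i) (power_law c alpha)) ->
  (forall n, 0 < r n) ->
  n%:R * r n `^ (- alpha) @[n --> \oo] --> (0 : R) ->
  (((n%:R * r n `^ (d%:R - alpha))^-1)%:E * 'E_P[outer_betti X r 0 n]
     @[n --> \oo] --> mu_p0 d c alpha)%E /\
  (forall k, (1 <= k <= d.-1)%N ->
    ((n%:R ^+ k.+2 * r n `^ (d%:R - alpha * k.+2%:R))^-1)%:E *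
        'E_P[outer_betti X r k n]
      @[n --> \oo] --> mu_p d c alpha k)%E.
Proof.
move=> _ dalpha c0 int1 Xind Xdens r0 nr0.
have sphE := sphere_areaE dalpha c0 int1.
split.
  have := @expectation_cvg _ _ _ _ _ X alpha c r dalpha c0 int1 Xind Xdens r0 nr0 0
    xpredT 0 (fun n w I => True) (outer_betti X r 0).
  have -> : mu_p0 d c alpha = (1`!%:R^-1 * (c ^+ 1 *
      fine (shape_integral (xpredT : 1.-tuple (d.-tuple (measurableTypeR R)) -> bool)) *
     (d%:R / (alpha * 1%:R - d%:R) * fine (ball_volume d : \bar R))))%:E.
    have mcst : measurable_fun [set: 0.-tuple (d.-tuple (measurableTypeR R))] (cst (1%:R : R)%:E).
      exact: measurable_cst.
    rewrite /mu_p0 sphE -EFinM /shape_integral integral_mpow0//=.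
    by congr EFin; rewrite factS fact0 muln1 invr1 mulr1n expr1 !mulr1; field; rewrite subr_eq0 gt_eqF.
  rewrite !mulr1 expr1; apply => //.
  - by move=> t i _; rewrite (ord1 i) edistxx.
  - move=> n w; have := @betti0_le_clusters _ _ _ _ _ _ (mem_outer_sample X (r n) n w).
    by rewrite -(ler_nat R) natrD.
  - move=> n w; have := @clusters_le_betti0 _ _ _ _ _ _ (mem_outer_sample X (r n) n w).
    by rewrite -(ler_nat R) natrD.
move=> k /andP[k0 _].
pose h (t : k.+2.-tuple (d.-tuple (measurableTypeR R))) := `[< hollow_tuple (t : k.+2.-tuple (d.-tuple R)) >].
have mh : measurable_fun setT h.
  apply: (measurable_fun_bool true); rewrite setTI.
  rewrite (_ : _ @^-1` _ = [set t | hollow_tuple (t : k.+2.-tuple (d.-tuple R))]).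
    exact: measurable_hollow_tuple.
  by apply/seteqP; split=> t /=; [move=> /asboolP|move=> ht; apply/asboolP].
have -> : mu_p d c alpha k = ((k.+2)`!%:R^-1 * (c ^+ k.+2 * fine (shape_integral h) *
     (d%:R / (alpha * k.+2%:R - d%:R) * fine (ball_volume d : \bar R))))%:E.
  rewrite /mu_p sphE -EFinM.
  have -> : (\int[mpow (lebesgue_Rd d) k.+1]_y (cycle_ind0 (y : k.+1.-tuple (d.-tuple R)))%:E =
      (fine (shape_integral h))%:E)%E.
    have h_near t i : h t -> edist (tnth t ord0) (tnth t i) <= 2.
      by move=> /asboolP ht; apply: (hollow_at_dist k0 ht); rewrite inE.
    rewrite fineK; last first.
      rewrite ge0_fin_numE ?shape_integral_ge0//.
      exact: (shape_integral_lty dalpha c0 (Xdens 0%N) mh (ler0n _ 2) h_near).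
    by apply: eq_integral => y _; rewrite cycle_ind0E.
  have a0 : 0 < alpha by exact: le_lt_trans dalpha.
  have bd : alpha * k.+2%:R - d%:R != 0.
    by rewrite subr_eq0 gt_eqF// (lt_le_trans dalpha)// ler_peMr ?(ltW a0)// ler1n.
  have ff : (k.+2)`!%:R != 0 :> R by rewrite pnatr_eq0 -lt0n fact_gt0.
  rewrite -!EFinM; congr EFin.
  move: (alpha * k.+2%:R - d%:R) ((k.+2)`!%:R : R) (c ^+ k.+2) bd ff => y z e y0 z0.
  by field; rewrite y0 z0.
apply: (@expectation_cvg _ _ _ _ _ X alpha c r dalpha c0 int1 Xind Xdens r0 nr0 k.+1 h 2
   (fun n w => hollow_at (fun i : 'I_n => X i w : d.-tuple R) k)) => //.
- by move=> z t; apply: asbool_equiv_eq; exact: hollow_tuple_translate.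
- by move=> t i /asboolP ht; apply: (hollow_at_dist k0 ht); rewrite inE.
- by move=> n w I cI; rewrite hollow_at_subsample//; split=> [/asboolP|/asboolP].
- move=> n w; have := betti_le_clusters (mem_outer_sample X (r n) n w) k0.
  by rewrite -(ler_nat R) natrD.
- move=> n w; have := clusters_le_betti (mem_outer_sample X (r n) n w) k0.
  by rewrite -(ler_nat R) natrD.
Qed.
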